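(* Let $b\in\mathbb{C}$ and let $\mathcal{M}_b=\mathrm{Spec}\big(\mathbb{C}[x_1,x_2,x_3]/(t-b)\big)$, where $t=-2+x_1^2+x_2^2+x_3^2-x_1x_2x_3$. If $b^2-4\neq0$, then the algebraic de Rham cohomology of $\mathcal{M}_b$ satisfies $h^0=1$ and $h^1=0$.
   Context: For an affine variety $U$ over $\mathbb{C}$, $(\Omega_U^\bullet,d)$ is its algebraic de Rham complex (global Kähler differential forms) with differentials $d_i:\Omega_U^i\to\Omega_U^{i+1}$, and $h^i=\dim_{\mathbb{C}}\big(\ker(d_i)/\mathrm{im}(d_{i-1})\big)$. $\mathcal{M}_b$ is the relative $\mathrm{SL}(2,\mathbb{C})$-representation variety of the one-holed torus with boundary trace $b$. *)

(* Defs.v *)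
From HB Require Import structures.
From mathcomp Require Import all_boot all_algebra.
From mathcomp Require Import boolp reals.
From mathcomp Require Import complex.
From mathcomp Require Import freeg mpoly.

Set Implicit Arguments.
Unset Strict Implicit.
Unset Printing Implicit Defensive.

Import GRing.Theory Num.Theory.

Local Open Scope ring_scope.
Local Open Scope quotient_scope.
Local Open Scope complex_scope.

Section Span.
Variables (R : pzRingType) (V : lmodType R) (G : V -> Prop).

Definition span : {pred V} :=
  fun v => `[< forall S : submodClosed V, (forall g, G g -> g \in S) -> v \in S >].

Fact span_submod_closed : subsemimod_closed span.
Proof.
split; first split.
- by apply/asboolP => S _; apply: rpred0.
- move=> x y /asboolP Sx /asboolP Sy; apply/asboolP => S GS.
  by rewrite rpredD ?Sx ?Sy.
- move=> a x /asboolP Sx; apply/asboolP => S GS.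
  by rewrite rpredZ ?Sx.
Qed.

HB.instance Definition _ := GRing.isSubmodClosed.Build R V span span_submod_closed.

Lemma mem_span g : G g -> g \in span.
Proof. by move=> Gg; apply/asboolP => S; apply. Qed.

Lemma span_sub (S : submodClosed V) :
  (forall g, G g -> g \in S) -> {subset span <= S}.
Proof. by move=> GS v /asboolP; apply. Qed.

Lemma span_ind (P : V -> Prop) :
    P 0 -> (forall a x y, P x -> P y -> P (a *: x + y)) ->
    (forall g, G g -> P g) ->
  forall v, v \in span -> P v.
Proof.
move=> P0 PD PG; pose S : V -> bool := fun v => `[< P v >].
have Scl : subsemimod_closed S.
  split; first split; first exact/asboolP.
    move=> x y /asboolP Px /asboolP Py; apply/asboolP.
    by rewrite -[x]scale1r; apply: PD.
  move=> a x /asboolP Px; apply/asboolP; rewrite -[_ *: _]addr0; exact: PD.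
pose T := GRing.SubmodClosed.Pack
  (GRing.SubmodClosed.Class (GRing.isAddClosed.Build V S Scl.1)
     (GRing.isScaleClosed.Build R V S Scl.2)).
move=> v /(@span_sub T) vT; apply/asboolP/vT => g Gg.
exact/asboolP/PG.
Qed.

End Span.

Section QuotientModule.
Variables (R : pzRingType) (V : lmodType R) (S : submodClosed V).

(* The quotient Z-module construction of the library asks for a predicate known
   to be closed under opposite. *)
Definition submod_zmod : {pred V} := S.

Fact submod_zmod_closed : zmod_closed submod_zmod.
Proof.
split=> [|x y Sx Sy]; first exact: (rpred0 S).
by rewrite -scaleN1r; apply: rpredD => //; apply: rpredZ.
Qed.

HB.instance Definition _ := GRing.isZmodClosed.Build V submod_zmod submod_zmod_closed.

Definition qmod : Type := Quotient.quot submod_zmod.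

HB.instance Definition _ := GRing.Zmodule.on qmod.
HB.instance Definition _ := Quotient.on qmod.

Definition qproj (v : V) : qmod := \pi_qmod v.

Lemma qprojD : {morph qproj : x y / x + y}.
Proof. by move=> x y; rewrite /qproj [LHS](@Quotient.pi_add _ submod_zmod). Qed.

Lemma qproj_eq x y : (qproj x == qproj y) = (x - y \in S).
Proof. by rewrite /qproj -[_ == _](@Quotient.idealrBE _ submod_zmod). Qed.

Lemma qprojK (v : qmod) : qproj (repr v) = v.
Proof. exact: reprK. Qed.

Lemma repr_qproj v : repr (qproj v) - v \in S.
Proof. by rewrite -qproj_eq qprojK. Qed.

Definition qscale (a : R) (v : qmod) : qmod := qproj (a *: repr v).

Lemma qscaleE a x : qscale a (qproj x) = qproj (a *: x).
Proof. by apply/eqP; rewrite qproj_eq -scalerBr rpredZ ?repr_qproj. Qed.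

Fact qscaleA a b v : qscale a (qscale b v) = qscale (a * b) v.
Proof. by rewrite -[v]qprojK !qscaleE scalerA. Qed.
Fact qscale1 : left_id 1 qscale.
Proof. by move=> v; rewrite -[v]qprojK !qscaleE scale1r. Qed.
Fact qscaleDr : right_distributive qscale +%R.
Proof.
by move=> a u v; rewrite -[u]qprojK -[v]qprojK !(=^~ qprojD, qscaleE) scalerDr.
Qed.
Fact qscaleDl v : {morph qscale^~ v : a b / a + b}.
Proof. by move=> a b; rewrite -[v]qprojK !qscaleE scalerDl qprojD. Qed.

HB.instance Definition _ :=
  GRing.Zmodule_isLmodule.Build R qmod qscaleA qscale1 qscaleDr qscaleDl.

Fact qproj_linear : linear qproj.
Proof. by move=> a x y; rewrite qprojD -qscaleE. Qed.

HB.instance Definition _ := GRing.isLinear.Build R V qmod *:%R qproj qproj_linear.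

Lemma qproj_eq0 v : (qproj v == 0) = (v \in S).
Proof. by rewrite -[0](raddf0 qproj) qproj_eq subr0. Qed.

End QuotientModule.

(* Prevents unification from unfolding the quotient constructions. *)
Global Opaque qmod qproj qscale.

Section QuotientLift.
Variables (R : pzRingType) (V : lmodType R) (G : V -> Prop) (N : zmodType).
Variable f : {additive V -> N}.
Hypothesis fG : forall a g, G g -> f (a *: g) = 0.

Lemma span_kill v : v \in span G -> f v = 0.
Proof.
move=> vS; rewrite -[v]scale1r; move: v vS (1 : R).
apply: span_ind => [a|c x y fx fy a|g Gg a]; first by rewrite scaler0 raddf0.
  by rewrite scalerDr scalerA raddfD /= fx fy addr0.
exact: fG.
Qed.

Lemma repr_qproj_span v : f (repr (qproj (span G) v)) = f v.
Proof.
apply/eqP; rewrite -subr_eq0 -raddfB /=.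
by rewrite span_kill //; apply: (repr_qproj (span G)).
Qed.

End QuotientLift.

Section FreeLift.
Variables (R : nzRingType) (K : choiceType) (N : zmodType).
Variable phi : K -> {additive R -> N}.

(* The additive map sending <<a *g x>> to phi x a. *)
Definition addlift (D : {freeg K / R}) : N := \sum_(x <- dom D) phi x (coeff x D).

Lemma addlift_sup (s : seq K) D : uniq s -> {subset dom D <= s} ->
  addlift D = \sum_(x <- s) phi x (coeff x D).
Proof.
move=> us sub; rewrite [RHS](bigID (mem (dom D))) /= [X in _ + X]big1 ?addr0.
  rewrite -big_filter; apply: perm_big; apply: uniq_perm.
  - exact: uniq_dom.
  - exact: filter_uniq.
  by move=> x; rewrite mem_filter; case: (boolP (x \in dom D)) => [/sub->|].
by move=> x /coeff_outdom->; rewrite raddf0.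
Qed.

Fact addlift_additive : zmod_morphism addlift.
Proof.
move=> D1 D2; set s := undup (dom D1 ++ dom D2).
have us : uniq s by rewrite undup_uniq.
have s1 : {subset dom D1 <= s} by move=> x xD; rewrite mem_undup mem_cat xD.
have s2 : {subset dom D2 <= s} by move=> x xD; rewrite mem_undup mem_cat xD orbT.
have s3 : {subset dom (D1 - D2) <= s} by move=> x /domB; rewrite mem_undup.
rewrite !(addlift_sup us) // -sumrB; apply: eq_bigr => x _.
by rewrite coeffB raddfB.
Qed.

HB.instance Definition _ :=
  GRing.isZmodMorphism.Build {freeg K / R} N addlift addlift_additive.

Lemma addliftU a x : addlift <<a *g x>> = phi x a.
Proof.
rewrite (@addlift_sup [:: x]) //; first by rewrite big_seq1 coeffU eqxx mulr1.
move=> y; rewrite mem_dom coeffU mem_seq1 [y == x]eq_sym.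
by case: (x =P y) => // _; rewrite mulr0 eqxx.
Qed.

End FreeLift.

Global Opaque addlift.

Lemma freeg_scaleU (R : nzRingType) (K : choiceType) (a b : R) (x : K) :
  a *: <<b *g x>> = <<a * b *g x>> :> {freeg K / R}.
Proof. by apply/eqP/freeg_eqP => y; rewrite coeffZ !coeffU mulrA. Qed.

Section Kaehler.
Variables (k : comNzRingType) (A : comAlgType k).

(* <<a>> stands for da. *)
Inductive kaehler_rel : {freeg A / A} -> Prop :=
| KaehlerAdd a b : kaehler_rel (<<a + b>> - <<a>> - <<b>>)
| KaehlerMul a b : kaehler_rel (<<a * b>> - a *: <<b>> - b *: <<a>>)
| KaehlerConst (c : k) : kaehler_rel <<c%:A>>.

Definition kaehler : Type := qmod (span kaehler_rel).

HB.instance Definition _ := GRing.Lmodule.on kaehler.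

Definition kd (a : A) : kaehler := qproj (span kaehler_rel) <<a>>.

Lemma kdE a : kd a = qproj (span kaehler_rel) <<a>>.
Proof. by []. Qed.

Lemma kdD a b : kd (a + b) = kd a + kd b.
Proof.
apply/eqP; rewrite -subr_eq0 opprD addrA /kd -!raddfB /= qproj_eq0.
exact/mem_span/KaehlerAdd.
Qed.

Lemma kdM a b : kd (a * b) = a *: kd b + b *: kd a.
Proof.
apply/eqP; rewrite -subr_eq0 opprD addrA /kd -!linearZ -!raddfB /= qproj_eq0.
exact/mem_span/KaehlerMul.
Qed.

Lemma kdC (c : k) : kd c%:A = 0.
Proof. by apply/eqP; rewrite /kd qproj_eq0; apply/mem_span/KaehlerConst. Qed.

Fact kd_zmod_morphism : zmod_morphism kd.
Proof. by move=> a b; apply/eqP; rewrite eq_sym subr_eq -kdD subrK. Qed.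

HB.instance Definition _ := GRing.isZmodMorphism.Build A kaehler kd kd_zmod_morphism.

Lemma kaehler_ind (P : kaehler -> Prop) :
    (forall om1 om2, P om1 -> P om2 -> P (om1 + om2)) ->
    (forall a b, P (a *: kd b)) ->
  forall om, P om.
Proof.
move=> PD PU om; rewrite -[om]qprojK -[repr om]freeg_sumE raddf_sum.
elim/big_ind: _ => [|//|b _]; first by rewrite -(scale0r (kd 0)).
by rewrite -[X in <<X *g b>>]mulr1 -freeg_scaleU /= linearZ; apply: PU.
Qed.

End Kaehler.

Arguments kd {k A}.

Global Opaque kd.

Section Exterior.
Variables (A : comNzRingType) (M : lmodType A).

(* The word [:: x1; ...; xn] stands for the tensor x1 (x) ... (x) xn: the first
   two families of relations present the tensor algebra of M, the third one
   spans its two-sided ideal generated by the squares x (x) x. *)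
Inductive ext_rel : {freeg (seq M) / A} -> Prop :=
| ExtAdd u v x y : ext_rel
    (<<u ++ x + y :: v>> - <<u ++ x :: v>> - <<u ++ y :: v>>)
| ExtScale u v a x : ext_rel (<<u ++ a *: x :: v>> - a *: <<u ++ x :: v>>)
| ExtAlt u v x : ext_rel <<u ++ [:: x, x & v]>>.

Definition exterior : Type := qmod (span ext_rel).

HB.instance Definition _ := GRing.Lmodule.on exterior.

Definition wedge (s : seq M) : exterior := qproj (span ext_rel) <<s>>.

(* The n-th exterior power, as a submodule of the exterior algebra. *)
Definition extpow (n : nat) : {pred exterior} :=
  span (fun w => exists2 s, size s = n & w = wedge s).

HB.instance Definition _ n := GRing.SubmodClosed.on (extpow n).

Lemma wedge_extpow s : wedge s \in extpow (size s).
Proof. by apply: (@mem_span _ _ _ (wedge s)); exists s. Qed.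

Lemma wedgeD u v x y :
  wedge (u ++ x + y :: v) = wedge (u ++ x :: v) + wedge (u ++ y :: v).
Proof.
apply/eqP; rewrite -subr_eq0 opprD addrA /wedge -!raddfB /= qproj_eq0.
exact/mem_span/ExtAdd.
Qed.

Lemma wedgeZ u v a x : wedge (u ++ a *: x :: v) = a *: wedge (u ++ x :: v).
Proof.
apply/eqP; rewrite -subr_eq0 /wedge -linearZ -!raddfB /= qproj_eq0.
exact/mem_span/ExtScale.
Qed.

Lemma wedge_alt u v x : wedge (u ++ [:: x, x & v]) = 0.
Proof. by apply/eqP; rewrite /wedge qproj_eq0; apply/mem_span/ExtAlt. Qed.

Lemma wedge_anti u v x y :
  wedge (u ++ [:: x, y & v]) = - wedge (u ++ [:: y, x & v]).
Proof.
apply/eqP; rewrite -addr_eq0; apply/eqP.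
have E z : wedge (u ++ [:: z, x + y & v])
    = wedge (u ++ [:: z, x & v]) + wedge (u ++ [:: z, y & v]).
  by rewrite -!(cat_rcons z u) wedgeD.
by have := wedge_alt u v (x + y); rewrite wedgeD !E !wedge_alt add0r addr0.
Qed.

Lemma exteriorE (w : exterior) :
  w = \sum_(s <- dom (repr w : {freeg (seq M) / A})) coeff s (repr w) *: wedge s.
Proof.
rewrite -[LHS]qprojK -[X in qproj _ X]freeg_sumE raddf_sum; apply: eq_bigr => s _.
by rewrite /wedge -linearZ freeg_scaleU mulr1.
Qed.

Lemma ext_ind (P : exterior -> Prop) :
    (forall w1 w2, P w1 -> P w2 -> P (w1 + w2)) ->
    (forall a s, P (a *: wedge s)) ->
  forall w, P w.
Proof.
move=> PD PU w; rewrite [w]exteriorE; elim/big_ind: _ => [|//|s _]; last exact: PU.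
by rewrite -(scale0r (wedge [::])); apply: PU.
Qed.

(* Additive maps out of the exterior algebra, from their values on the
   a *: wedge s. *)
Section Lift.
Variables (N : zmodType) (phi : seq M -> {additive A -> N}).
Hypothesis phi_rel : forall a r, ext_rel r -> addlift phi (a *: r) = 0.

Definition extlift (w : exterior) : N := addlift phi (repr w).

Lemma extlift_proj D : extlift (qproj (span ext_rel) D) = addlift phi D.
Proof. exact: (repr_qproj_span phi_rel). Qed.

Fact extlift_additive : zmod_morphism extlift.
Proof.
move=> x y; rewrite -{1}[x]qprojK -{1}[y]qprojK -raddfB extlift_proj.
exact: raddfB.
Qed.

Lemma extliftU a s : extlift (a *: wedge s) = phi s a.
Proof. by rewrite /wedge -linearZ extlift_proj freeg_scaleU mulr1 addliftU. Qed.

End Lift.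

End Exterior.

Arguments extpow {A} M n.

Global Opaque wedge extlift.

(* lmul x w is x /\ w. *)
Section LeftMul.
Variables (A : comNzRingType) (M : lmodType A).

Section Def.
Variable x : M.

Definition lmul_phi (s : seq M) (a : A) : exterior M := a *: wedge (x :: s).

Fact lmul_phi_additive s : zmod_morphism (lmul_phi s).
Proof. by move=> a b; apply: scalerBl. Qed.

HB.instance Definition _ s :=
  GRing.isZmodMorphism.Build A (exterior M) (lmul_phi s) (lmul_phi_additive s).

Fact lmul_rel a r : ext_rel r -> addlift lmul_phi (a *: r) = 0.
Proof.
case=> [u v y z|u v b y|u v y];
  rewrite ?scalerBr ?freeg_scaleU ?raddfB /= !addliftU /= /lmul_phi ?mulr1 -!cat_cons.
- by rewrite wedgeD scalerDr addrAC addrK subrr.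
- by rewrite wedgeZ scalerA subrr.
- by rewrite wedge_alt scaler0.
Qed.

Definition lmul : exterior M -> exterior M := extlift lmul_phi.

Lemma lmulU a s : lmul (a *: wedge s) = a *: wedge (x :: s).
Proof. exact: (extliftU lmul_rel). Qed.

HB.instance Definition _ := GRing.isZmodMorphism.Build (exterior M) (exterior M)
  lmul (extlift_additive lmul_rel).

Fact lmul_scalable : scalable lmul.
Proof.
move=> a w; elim/ext_ind: w => [w1 w2 E1 E2|b s].
  by rewrite !raddfD /= E1 E2.
by rewrite scalerA !lmulU scalerA.
Qed.

HB.instance Definition _ := GRing.isScalable.Build A (exterior M) (exterior M) *:%R
  lmul lmul_scalable.

Lemma lmul_wedge s : lmul (wedge s) = wedge (x :: s).
Proof. by rewrite -[wedge s]scale1r lmulU scale1r. Qed.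

End Def.

Lemma lmulDr x w1 w2 : lmul x (w1 + w2) = lmul x w1 + lmul x w2.
Proof. exact: raddfD. Qed.

Lemma lmulNr x w : lmul x (- w) = - lmul x w.
Proof. exact: raddfN. Qed.

Lemma lmulBr x w1 w2 : lmul x (w1 - w2) = lmul x w1 - lmul x w2.
Proof. exact: raddfB. Qed.

Lemma lmul0r x : lmul x 0 = 0.
Proof. exact: raddf0. Qed.

Lemma lmulZr a x w : lmul x (a *: w) = a *: lmul x w.
Proof. exact: linearZ. Qed.

Lemma lmulDl x y w : lmul (x + y) w = lmul x w + lmul y w.
Proof.
elim/ext_ind: w => [w1 w2 E1 E2|a s]; first by rewrite !raddfD /= E1 E2 addrACA.
by rewrite !lmulU -scalerDr -(wedgeD [::]).
Qed.

Lemma lmulZl a x w : lmul (a *: x) w = a *: lmul x w.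
Proof.
elim/ext_ind: w => [w1 w2 E1 E2|b s]; first by rewrite !raddfD /= E1 E2.
by rewrite !lmulU (wedgeZ [::]) !scalerA mulrC.
Qed.

Lemma lmulBl x y w : lmul (x - y) w = lmul x w - lmul y w.
Proof. by rewrite -scaleN1r lmulDl lmulZl scaleN1r. Qed.

Lemma lmul_anti x y w : lmul x (lmul y w) = - lmul y (lmul x w).
Proof.
elim/ext_ind: w => [w1 w2 E1 E2|a s]; first by rewrite !raddfD /= E1 E2.
by rewrite !lmulU (wedge_anti [::]) scalerN.
Qed.

Lemma lmul_alt x w : lmul x (lmul x w) = 0.
Proof.
elim/ext_ind: w => [w1 w2 E1 E2|a s]; first by rewrite !raddfD /= E1 E2 addr0.
by rewrite !lmulU (wedge_alt [::]) scaler0.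
Qed.

End LeftMul.

Global Opaque lmul.

Section DeRham.
Variables (k : comNzRingType) (A : comAlgType k).
Local Notation Om1 := (kaehler A).
Local Notation Om := (exterior (kaehler A)).

(* Left multiplication by the 2-form d omega, for a 1-form omega: it sends w to
   the sum of the da /\ db /\ w, for omega a sum of forms a db. *)
Section DMul.
Variable w : Om.

Definition dmul_phi (b a : A) : Om := lmul (kd a) (lmul (kd b) w).

Fact dmul_phi_additive b : zmod_morphism (dmul_phi b).
Proof. by move=> a1 a2; rewrite /dmul_phi raddfB lmulBl. Qed.

HB.instance Definition _ b :=
  GRing.isZmodMorphism.Build A Om (dmul_phi b) (dmul_phi_additive b).

Fact dmul_rel c r : kaehler_rel r -> addlift dmul_phi (c *: r) = 0.
Proof.
case=> [a b|a b|t]; rewrite ?scalerBr ?freeg_scaleU ?raddfB /= ?freeg_scaleU.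
- by rewrite !addliftU /= /dmul_phi kdD lmulDl lmulDr addrAC addrK subrr.
- rewrite !addliftU /= /dmul_phi !mulr1 !kdM !lmulDl !lmulDr !lmulZl !lmulZr.
  rewrite (lmul_anti (kd b) (kd a)) scalerN -addrA -opprD.
  by rewrite [X in _ - X]addrACA subrr add0r subrr.
- by rewrite addliftU /= /dmul_phi kdC -[0](scale0r 0) lmulZl scale0r raddf0.
Qed.

Definition dmul (om : Om1) : Om := addlift dmul_phi (repr om).

Lemma dmul_proj D : dmul (qproj (span (@kaehler_rel k A)) D) = addlift dmul_phi D.
Proof. exact: (repr_qproj_span dmul_rel). Qed.

Fact dmul_additive : zmod_morphism dmul.
Proof.
move=> x y; rewrite -{1}[x]qprojK -{1}[y]qprojK -raddfB dmul_proj.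
exact: raddfB.
Qed.

HB.instance Definition _ := GRing.isZmodMorphism.Build Om1 Om dmul dmul_additive.

Lemma dmulU a b : dmul (a *: kd b) = lmul (kd a) (lmul (kd b) w).
Proof. by rewrite kdE -linearZ dmul_proj freeg_scaleU mulr1 addliftU. Qed.

End DMul.

Local Opaque dmul.

Lemma dmul_linear om w1 w2 a :
  dmul (a *: w1 + w2) om = a *: dmul w1 om + dmul w2 om.
Proof.
elim/kaehler_ind: om => [om1 om2 E1 E2|b c].
  by rewrite !raddfD /= E1 E2 addrACA.
by rewrite !dmulU !linearP.
Qed.

Lemma dmulDr om w1 w2 : dmul (w1 + w2) om = dmul w1 om + dmul w2 om.
Proof. by rewrite -[w1]scale1r dmul_linear !scale1r. Qed.

Lemma dmul0 om : dmul 0 om = 0.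
Proof. by apply: (addrI (dmul 0 om)); rewrite -dmulDr !addr0. Qed.

Lemma dmulZr om w a : dmul (a *: w) om = a *: dmul w om.
Proof. by rewrite -[X in dmul X]addr0 dmul_linear dmul0 addr0. Qed.

Lemma dmulZl a om w : dmul w (a *: om) = a *: dmul w om + lmul (kd a) (lmul om w).
Proof.
elim/kaehler_ind: om => [om1 om2 E1 E2|b c].
  by rewrite scalerDr !raddfD /= E1 E2 lmulDl raddfD /= addrACA.
rewrite scalerA !dmulU kdM lmulDl !lmulZl lmulZr.
by rewrite addrC.
Qed.

Lemma dmul_lmul x om w : dmul (lmul x w) om = lmul x (dmul w om).
Proof.
elim/kaehler_ind: om => [om1 om2 E1 E2|b c]; first by rewrite !raddfD /= E1 E2.
by rewrite !dmulU (lmul_anti (kd c) x) lmulNr (lmul_anti (kd b) x) opprK.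
Qed.

Lemma dmul_kd b w : dmul w (kd b) = 0.
Proof. by rewrite -[kd b]scale1r dmulU -[1]scale1r kdC -[0](scale0r 0) lmulZl scale0r. Qed.

(* d (x1 /\ ... /\ xn), by the graded Leibniz rule
   d (x /\ w) = dx /\ w - x /\ dw for a 1-form x. *)
Fixpoint dword (s : seq Om1) : Om :=
  if s is x :: s' then dmul (wedge s') x - lmul x (dword s') else 0.

Definition diff_phi (s : seq Om1) (a : A) : Om := lmul (kd a) (wedge s) + a *: dword s.

Fact diff_phi_additive s : zmod_morphism (diff_phi s).
Proof. by move=> a b; rewrite /diff_phi raddfB lmulBl scalerBl opprD addrACA. Qed.

HB.instance Definition _ s :=
  GRing.isZmodMorphism.Build A Om (diff_phi s) (diff_phi_additive s).

Lemma dword_add u v x y :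
  dword (u ++ x + y :: v) = dword (u ++ x :: v) + dword (u ++ y :: v).
Proof.
elim: u => [|z u IHu] /=; first by rewrite raddfD lmulDl opprD addrACA.
by rewrite IHu wedgeD dmulDr lmulDr opprD addrACA.
Qed.

Lemma dword_scale u v a x :
  dword (u ++ a *: x :: v) = a *: dword (u ++ x :: v) + lmul (kd a) (wedge (u ++ x :: v)).
Proof.
elim: u => [|z u IHu] /=.
  by rewrite dmulZl lmulZl lmul_wedge scalerBr addrAC.
rewrite IHu wedgeZ dmulZr lmulDr lmulZr scalerBr opprD addrA; congr (_ + _).
by rewrite lmul_anti opprK lmul_wedge.
Qed.

Lemma dword_alt u v x : dword (u ++ [:: x, x & v]) = 0.
Proof.
elim: u => [|z u IHu] /=; last by rewrite IHu wedge_alt dmul0 lmul0r subr0.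
by rewrite lmulBr lmul_alt subr0 -lmul_wedge dmul_lmul subrr.
Qed.

Fact diff_rel a r : ext_rel r -> addlift diff_phi (a *: r) = 0.
Proof.
case=> [u v x y|u v b x|u v x];
  rewrite ?scalerBr ?freeg_scaleU ?raddfB /= !addliftU /= /diff_phi ?mulr1.
- rewrite wedgeD dword_add lmulDr scalerDr addrACA.
  by rewrite [X in X - _]addrAC addrK subrr.
- rewrite wedgeZ dword_scale kdM lmulDl !lmulZl lmulZr scalerDr scalerA.
  by rewrite [X in _ - X]addrAC [X in _ - X]addrC [X in _ - (_ + X)]addrC subrr.
- by rewrite wedge_alt dword_alt lmul0r scaler0 addr0.
Qed.

(* The exterior derivative; by form_ind below, diff_symbol characterizes it. *)
Definition diff : Om -> Om := extlift diff_phi.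

HB.instance Definition _ :=
  GRing.isZmodMorphism.Build Om Om diff (extlift_additive diff_rel).

Lemma diffU a s : diff (a *: wedge s) = lmul (kd a) (wedge s) + a *: dword s.
Proof. exact: (extliftU diff_rel). Qed.

Lemma dword_kd (s : seq A) : dword (map kd s) = 0.
Proof. by elim: s => //= b s ->; rewrite dmul_kd lmul0r subr0. Qed.

Lemma diff_symbol (a : A) (s : seq A) :
  diff (a *: wedge (map kd s)) = wedge (map kd (a :: s)).
Proof. by rewrite diffU dword_kd scaler0 addr0 lmul_wedge. Qed.

Lemma form_ind (P : Om -> Prop) :
    (forall w1 w2, P w1 -> P w2 -> P (w1 + w2)) ->
    (forall a (s : seq A), P (a *: wedge (map kd s))) ->
  forall w, P w.
Proof.
move=> PD PU; have PW s t a : P (a *: wedge (map kd t ++ s)).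
  elim: s t a => [|x s IHs] t a; first by rewrite cats0.
  elim/kaehler_ind: x t a => [x y Px Py|c b] t a.
    by rewrite wedgeD scalerDr; apply: PD.
  by rewrite wedgeZ scalerA -cat_rcons -map_rcons.
by apply: ext_ind => // a s; apply: (PW s [::]).
Qed.

Lemma diff_diff w : diff (diff w) = 0.
Proof.
elim/form_ind: w => [w1 w2 E1 E2|a s]; first by rewrite !raddfD /= E1 E2 addr0.
rewrite diff_symbol -[wedge _]scale1r diff_symbol /= -lmul_wedge.
by rewrite -[1]scale1r kdC -[0](scale0r 0) lmulZl scale0r.
Qed.

Lemma diffZ (c : k) w : diff (c%:A *: w) = c%:A *: diff w.
Proof.
elim/form_ind: w => [w1 w2 E1 E2|a s]; first by rewrite !raddfD /= E1 E2.
rewrite scalerA !diff_symbol /= -!lmul_wedge kdM kdC scaler0 addr0 lmulZl.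
by [].
Qed.

Lemma lmul_extpow n x w : w \in extpow Om1 n -> lmul x w \in extpow Om1 n.+1.
Proof.
move: w; apply: span_ind => [|a w1 w2 W1 W2|_ [s <- ->]]; first by rewrite lmul0r rpred0.
  by rewrite lmulDr lmulZr rpredD ?rpredZ.
by rewrite lmul_wedge; apply: (wedge_extpow (x :: s)).
Qed.

Lemma dmul_extpow n om w : w \in extpow Om1 n -> dmul w om \in extpow Om1 n.+2.
Proof.
move=> wn; elim/kaehler_ind: om => [x y Dx Dy|a b].
  by rewrite raddfD rpredD.
by rewrite dmulU; do 2!apply: lmul_extpow.
Qed.

Lemma dword_extpow s : dword s \in extpow Om1 (size s).+1.
Proof.
elim: s => [|x s IHs] /=; first exact: rpred0.
rewrite -[_ - _]addrC -scaleN1r rpredD ?rpredZ ?lmul_extpow //.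
exact/dmul_extpow/wedge_extpow.
Qed.

Lemma diff_extpow n w : w \in extpow Om1 n -> diff w \in extpow Om1 n.+1.
Proof.
move=> wn; suff: forall a, diff (a *: w) \in extpow Om1 n.+1.
  by move/(_ 1); rewrite scale1r.
move: w wn; apply: span_ind => [|b w1 w2 W1 W2|_ [s <- ->]] a.
- by rewrite scaler0 raddf0 rpred0.
- by rewrite scalerDr scalerA raddfD rpredD.
rewrite diffU rpredD ?rpredZ ?dword_extpow ?lmul_extpow //.
exact: wedge_extpow.
Qed.

(* The direct sum of the Omega^n, as a module over k. *)
Definition deRham : Type := Om.

HB.instance Definition _ := GRing.Zmodule.on deRham.

Definition deRham_scale (c : k) (w : deRham) : deRham := (c%:A : A) *: (w : Om).

Fact deRham_scaleA a b w : deRham_scale a (deRham_scale b w) = deRham_scale (a * b) w.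
Proof. by rewrite /deRham_scale scalerA -scalerAl mul1r scalerA. Qed.
Fact deRham_scale1 : left_id 1 deRham_scale.
Proof. by move=> w; rewrite /deRham_scale !scale1r. Qed.
Fact deRham_scaleDr : right_distributive deRham_scale +%R.
Proof. by move=> a u v; rewrite /deRham_scale scalerDr. Qed.
Fact deRham_scaleDl w : {morph deRham_scale^~ w : a b / a + b}.
Proof. by move=> a b; rewrite /deRham_scale !scalerDl. Qed.

HB.instance Definition _ := GRing.Zmodule_isLmodule.Build k deRham
  deRham_scaleA deRham_scale1 deRham_scaleDr deRham_scaleDl.

Definition deRham_diff : deRham -> deRham := diff.

Fact deRham_diff_linear : linear deRham_diff.
Proof.
move=> c x y; rewrite /deRham_diff; apply: etrans (raddfD diff _ _) _.
by congr (_ + _); apply: diffZ.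
Qed.

HB.instance Definition _ :=
  GRing.isLinear.Build k deRham deRham *:%R deRham_diff deRham_diff_linear.

(* Omega^n, the n-th exterior power of the module of Kaehler differentials. *)
Definition forms (n : nat) : {pred deRham} := extpow Om1 n.

Fact forms_submod n : subsemimod_closed (forms n).
Proof.
split; first split; first exact: (rpred0 (extpow Om1 n)).
  exact: (@rpredD _ (extpow Om1 n)).
by move=> c x; apply: (@rpredZ _ _ (extpow Om1 n)).
Qed.

HB.instance Definition _ n :=
  GRing.isSubmodClosed.Build k deRham (forms n) (forms_submod n).

(* The kernel of d_n : Omega^n -> Omega^(n+1). *)
Definition closed_form (n : nat) : {pred deRham} :=
  [pred w | (w \in forms n) && (deRham_diff w == 0)].

Fact closed_form_submod n : subsemimod_closed (closed_form n).
Proof.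
split; first split.
- by rewrite inE rpred0 raddf0 /=.
- move=> x y; rewrite !inE => /andP[xn /eqP dx] /andP[yn /eqP dy].
  by rewrite rpredD // raddfD /= dx dy addr0 /=.
- move=> c x; rewrite !inE => /andP[xn /eqP dx].
  by rewrite rpredZ // linearZ /= dx scaler0 /=.
Qed.

HB.instance Definition _ n :=
  GRing.isSubmodClosed.Build k deRham (closed_form n) (closed_form_submod n).

Definition closed_forms (n : nat) : Type := {w : deRham | w \in closed_form n}.

HB.instance Definition _ n := SubChoice.on (closed_forms n).
HB.instance Definition _ n := [SubChoice_isSubLmodule of closed_forms n by <:].

(* The image of d_(n-1) : Omega^(n-1) -> Omega^n; it is 0 for n = 0. *)
Definition exact_form (n : nat) : {pred closed_forms n} := fun z =>
  if n is m.+1 then `[< exists2 w, w \in forms m & val z = deRham_diff w >]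
  else val z == 0.

Fact exact_form_submod n : subsemimod_closed (@exact_form n).
Proof.
case: n => [|n]; (split; first split).
- exact/eqP.
- by move=> x y /eqP x0 /eqP y0; apply/eqP; rewrite raddfD /= x0 y0 addr0.
- by move=> c x /eqP x0; apply/eqP; rewrite linearZ /= x0 scaler0.
- by apply/asboolP; exists 0; rewrite ?raddf0 ?rpred0.
- move=> x y /asboolP[u un xu] /asboolP[v vn yv]; apply/asboolP.
  by exists (u + v); rewrite ?rpredD // !raddfD /= xu yv.
- move=> c x /asboolP[u un xu]; apply/asboolP.
  by exists (c *: u); rewrite ?rpredZ // !linearZ /= xu.
Qed.

HB.instance Definition _ n :=
  GRing.isSubmodClosed.Build k (closed_forms n) (@exact_form n) (@exact_form_submod n).

Definition deRham_coh (n : nat) : Type := qmod (@exact_form n).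

HB.instance Definition _ n := GRing.Lmodule.on (deRham_coh n).

End DeRham.

(* V is free of rank m; over a field, dim V = m. *)
Definition has_dim (k : nzRingType) (V : lmodType k) (m : nat) : Prop :=
  inhabited (Vector.axiom m V).

Section QuotientAlgebra.
Variables (k : comNzRingType) (P : comAlgType k) (I : idealr P).

Definition qalg : Type := {ideal_quot I}.

HB.instance Definition _ := GRing.ComNzRing.on qalg.

Definition qalg_proj (p : P) : qalg := \pi_{ideal_quot I} p.

Fact qalg_proj_zmod : zmod_morphism qalg_proj.
Proof. exact: raddfB. Qed.
Fact qalg_proj_monoid : monoid_morphism qalg_proj.
Proof. by split; [apply: rmorph1 | apply: rmorphM]. Qed.

HB.instance Definition _ := GRing.isZmodMorphism.Build P qalg qalg_proj qalg_proj_zmod.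
HB.instance Definition _ := GRing.isMonoidMorphism.Build P qalg qalg_proj qalg_proj_monoid.

Definition qalg_scale (c : k) (x : qalg) : qalg := qalg_proj c%:A * x.

Fact qalg_scaleA a b x : qalg_scale a (qalg_scale b x) = qalg_scale (a * b) x.
Proof. by rewrite /qalg_scale mulrA -rmorphM /= -scalerAl mul1r scalerA. Qed.
Fact qalg_scale1 : left_id 1 qalg_scale.
Proof. by move=> x; rewrite /qalg_scale scale1r rmorph1 mul1r. Qed.
Fact qalg_scaleDr : right_distributive qalg_scale +%R.
Proof. by move=> a x y; apply: mulrDr. Qed.
Fact qalg_scaleDl x : {morph qalg_scale^~ x : a b / a + b}.
Proof. by move=> a b; rewrite /qalg_scale scalerDl raddfD mulrDl. Qed.

HB.instance Definition _ := GRing.Zmodule_isLmodule.Build k qalg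
  qalg_scaleA qalg_scale1 qalg_scaleDr qalg_scaleDl.

Fact qalg_scaleAl (c : k) (x y : qalg) : c *: (x * y) = (c *: x) * y.
Proof. exact: mulrA. Qed.

HB.instance Definition _ := GRing.Lmodule_isLalgebra.Build k qalg qalg_scaleAl.
HB.instance Definition _ := GRing.Lalgebra_isComAlgebra.Build k qalg.

End QuotientAlgebra.

Section RelativeVariety.
Variables (R : realType) (b : R[i]).

(* The trace of a commutator of A and B in SL(2, C), for x1 = tr A, x2 = tr B
   and x3 = tr AB. *)
Definition boundary_trace : {mpoly R[i][3]} :=
  let x1 := 'X_0 in let x2 := 'X_1 in let x3 := 'X_2 in
  - 2 + x1 ^+ 2 + x2 ^+ 2 + x3 ^+ 2 - x1 * x2 * x3.

Definition boundary_ideal : {pred {mpoly R[i][3]}} :=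
  fun p => `[< exists q, p = q * (boundary_trace - b%:MP) >].

Fact boundary_idealr_closed : idealr_closed boundary_ideal.
Proof.
split.
- by apply/asboolP; exists 0; rewrite mul0r.
- apply/asboolP => -[q].
  move=> /(congr1 (meval (fun i => if i == 0 then sqrtC (b + 2) else 0))).
  rewrite rmorph1 rmorphM /= /boundary_trace.
  rewrite !(rmorphB, rmorphD, rmorphXn, rmorphM, rmorphN) /= !mevalXU mevalC /=.
  rewrite sqrtCK mevalC expr0n mulr0 !addr0 subr0 [b + 2]addrC addKr subrr mulr0.
  by apply/eqP; rewrite oner_eq0.
move=> p u v /asboolP[q1 ->] /asboolP[q2 ->]; apply/asboolP.
by exists (p * q1 + q2); rewrite mulrDl mulrA.
Qed.

HB.instance Definition _ :=
  isIdealr.Build {mpoly R[i][3]} boundary_ideal boundary_idealr_closed.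

(* The coordinate ring of M_b = Spec (C[x1, x2, x3] / (t - b)). Since M_b is
   affine, its global differential forms are the elements of the exterior
   algebra of the module of Kaehler differentials of this ring. *)
Definition coord_ring : Type := qalg boundary_ideal.

HB.instance Definition _ := GRing.ComAlgebra.on coord_ring.

End RelativeVariety.

(* Main.v *)
Require Import Defs.
From HB Require Import structures.
From mathcomp Require Import all_boot all_algebra.
From mathcomp Require Import reals complex.
From mathcomp Require Import boolp ring.
From mathcomp Require Import freeg mpoly.

(** Write x = x1, y = x2, and replace x3 by w = 2 x3 - x1 x2, which changes
sign under the involution x3 |-> x1 x2 - x3 of the surface. The equation
t = b becomes w^2 = D with D = (x^2 - 4) (y^2 - 4) - m and m = 8 - 4 b, so the
coordinate ring is A = T + T w, for T = C[x, y], a double cover of the plane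
branched along D = 0. The condition b^2 <> 4 says that m is neither 0 nor 16,
that is, that D and its two partial derivatives generate the unit ideal
(disc_smooth).

The vector fields w d/dx and w d/dy extend to derivations of A
(derivation_ex). Contraction with them turns a 1-form om into a pair of
functions (P, Q), with w om = P dx + Q dy; by smoothness om is determined by
this pair (contractions_inj). Split P = P0 + P1 w and Q = Q0 + Q1 w into even
and odd parts for the involution. If om is closed, then:
- P1 dx + Q1 dy is a closed form on the plane, so it is df for a polynomial f
  (poincare);
- P0 dx + Q0 dy satisfies D (dQ0/dx - dP0/dy) = (D_x Q0 - D_y P0) / 2, and this
  twisted closedness implies P0 = D g_x + D_x g / 2 and Q0 = D g_y + D_y g / 2
  for a polynomial g (twisted_poincare).
Then f + g w has differential om. Formally, the second point says that
(P0 dx + Q0 dy) / sqrt D, when closed, is the differential of g sqrt D. It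
holds by induction on the degree of P0 in x, since D is quadratic in x with
leading coefficient Y = y^2 - 4: the coefficient of Q0 on the next power of x
forces Y to divide the leading coefficient of P0, which can then be removed.
The induction stops because the equation Y r' = y r of sqrt Y has no nonzero
polynomial solution.

The same derivations show that a function f + g w with zero differential has
f constant and g = 0 (twistX_eq0), which gives h^0 = 1. *)

Set Implicit Arguments.
Unset Strict Implicit.
Unset Printing Implicit Defensive.

Import GRing.Theory Num.Theory.
Local Open Scope ring_scope.
Local Open Scope complex_scope.

(** * Detecting differential forms *)

Section Contraction.
Variables (k : comNzRingType) (A : comAlgType k) (delta : {additive A -> A}).
Hypothesis deltaM : forall a b, delta (a * b) = a * delta b + b * delta a.
Hypothesis deltaC : forall c : k, delta c%:A = 0.

Definition contract_phi (b a : A) : A := a * delta b.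

Fact contract_phi_additive b : zmod_morphism (contract_phi b).
Proof. by move=> a1 a2; apply: mulrBl. Qed.

HB.instance Definition _ b :=
  GRing.isZmodMorphism.Build A A (contract_phi b) (contract_phi_additive b).

Fact contract_rel c r : kaehler_rel r -> addlift contract_phi (c *: r) = 0.
Proof.
case=> [a b|a b|t]; rewrite ?scalerBr ?freeg_scaleU ?raddfB /= ?freeg_scaleU
  !addliftU /= /contract_phi.
- by rewrite raddfD /=; ring.
- by rewrite deltaM; ring.
- by rewrite deltaC mulr0.
Qed.

Definition contract (om : kaehler A) : A := addlift contract_phi (repr om).

Lemma contract_proj v : contract (qproj (Defs.span (@kaehler_rel k A)) v) = addlift contract_phi v.
Proof. exact: (repr_qproj_span contract_rel). Qed.

Fact contract_additive : zmod_morphism contract.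
Proof.
move=> x y; rewrite -{1}[x]qprojK -{1}[y]qprojK -raddfB contract_proj.
exact: raddfB.
Qed.

HB.instance Definition _ := GRing.isZmodMorphism.Build (kaehler A) A contract contract_additive.

Lemma contractU a b : contract (a *: kd b) = a * delta b.
Proof. by rewrite kdE -linearZ contract_proj freeg_scaleU mulr1 addliftU. Qed.

Fact contract_scalable : scalable_for *%R contract.
Proof.
move=> a om; elim/kaehler_ind: om => [om1 om2 E1 E2|b c].
  by rewrite scalerDr !raddfD /= E1 E2 mulrDr.
by rewrite scalerA !contractU mulrA.
Qed.

HB.instance Definition _ :=
  GRing.isScalable.Build A (kaehler A) A *%R contract contract_scalable.

(** A derivation kills the relations that present the Kaehler differentials. *)
Lemma contraction_ex : exists f : {scalar kaehler A}, forall a, f (kd a) = delta a.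
Proof. by exists contract => a /=; rewrite -[kd a]scale1r contractU mul1r. Qed.

End Contraction.

Section AlternatingForm.
Variables (A : comNzRingType) (M : lmodType A) (c : seq M -> A).
Hypothesis c_add : forall u v x y, c (u ++ x + y :: v) = c (u ++ x :: v) + c (u ++ y :: v).
Hypothesis c_scale : forall u v a x, c (u ++ a *: x :: v) = a * c (u ++ x :: v).
Hypothesis c_alt : forall u v x, c (u ++ [:: x, x & v]) = 0.

Definition alt_phi (s : seq M) (a : A) : A := a * c s.

Fact alt_phi_additive s : zmod_morphism (alt_phi s).
Proof. by move=> a b; apply: mulrBl. Qed.

HB.instance Definition _ s :=
  GRing.isZmodMorphism.Build A A (alt_phi s) (alt_phi_additive s).

Fact alt_rel a r : ext_rel r -> addlift alt_phi (a *: r) = 0.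
Proof.
case=> [u v x y|u v b x|u v x];
  rewrite ?scalerBr ?freeg_scaleU ?raddfB /= !addliftU /= /alt_phi ?mulr1.
- by rewrite c_add; ring.
- by rewrite c_scale; ring.
- by rewrite c_alt mulr0.
Qed.

Definition alt_form : exterior M -> A := extlift alt_phi.

HB.instance Definition _ :=
  GRing.isZmodMorphism.Build (exterior M) A alt_form (extlift_additive alt_rel).

Lemma alt_formU a s : alt_form (a *: wedge s) = a * c s.
Proof. exact: (extliftU alt_rel). Qed.

Fact alt_form_scalable : scalable_for *%R alt_form.
Proof.
move=> a w; elim/ext_ind: w => [w1 w2 E1 E2|b s].
  by rewrite scalerDr !raddfD /= E1 E2 mulrDr.
by rewrite scalerA !alt_formU mulrA.
Qed.

HB.instance Definition _ :=
  GRing.isScalable.Build A (exterior M) A *%R alt_form alt_form_scalable.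

(** An alternating multilinear function of words kills the relations that
present the exterior algebra. *)
Lemma alt_form_ex : exists f : {scalar exterior M}, forall s, f (wedge s) = c s.
Proof. by exists alt_form => s /=; rewrite -[wedge s]scale1r alt_formU mul1r. Qed.

End AlternatingForm.

Lemma ext_form0 (A : comNzRingType) (M : lmodType A) :
  exists f : {scalar exterior M}, f (wedge [::]) = 1.
Proof.
have [|||f fE] := @alt_form_ex A M (fun s => (size s == 0)%:R); last by exists f; rewrite fE.
- by move=> u v x y; rewrite !size_cat !addnS addr0.
- by move=> u v a x; rewrite !size_cat !addnS mulr0.
- by move=> u v x; rewrite !size_cat !addnS.
Qed.

Lemma ext_form1 (A : comNzRingType) (M : lmodType A) (l : {scalar M}) :
  exists f : {scalar exterior M}, forall x, f (wedge [:: x]) = l x.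
Proof.
pose c (s : seq M) := if s is [:: x] then l x else 0.
have [|||f fE] := @alt_form_ex A M c; last by exists f => x; rewrite fE.
- by move=> [|t [|? u]] [|? v] x y //=; rewrite ?raddfD ?addr0.
- by move=> [|t [|? u]] [|? v] a x //=; rewrite ?linearZ ?mulr0.
- by move=> [|t [|? u]] v x.
Qed.

Lemma ext_form2 (A : comNzRingType) (M : lmodType A) (l1 l2 : {scalar M}) :
  exists f : {scalar exterior M},
    forall x y, f (wedge [:: x; y]) = l1 x * l2 y - l2 x * l1 y.
Proof.
pose c (s : seq M) := if s is [:: x; y] then l1 x * l2 y - l2 x * l1 y else 0.
have [|||f fE] := @alt_form_ex A M c; last by exists f => x y; rewrite fE.
- move=> [|s [|t [|? u]]] [|z [|? v]] x y //=; rewrite ?addr0 ?raddfD //=; ring.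
- move=> [|s [|t [|? u]]] [|z [|? v]] a x //=; rewrite ?mulr0 ?linearZ //=; ring.
- by move=> [|s [|t [|? u]]] [|z v] x //=; rewrite mulrC subrr.
Qed.

Lemma wedge0_inj (A : comNzRingType) (M : lmodType A) (a : A) :
  a *: wedge [::] = 0 :> exterior M -> a = 0.
Proof.
have [f f1] := ext_form0 M.
by move/(congr1 f); rewrite linearZ raddf0 /= f1 mulr1.
Qed.

(** * Cohomology in degrees 0 and 1 *)

Section LowDegree.
Variables (k : comNzRingType) (A : comAlgType k).
Local Notation Om1 := (kaehler A).

Lemma form0P (w : exterior Om1) : w \in extpow Om1 0 -> exists a, w = a *: wedge [::].
Proof.
move: w; apply: span_ind => [|a _ _ [x ->] [y ->]|_ [[//|//] _ ->]].
- by exists 0; rewrite scale0r.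
- by exists (a * x + y); rewrite scalerA scalerDl.
- by exists 1; rewrite scale1r.
Qed.

Lemma form1P (w : exterior Om1) : w \in extpow Om1 1 -> exists om : Om1, w = wedge [:: om].
Proof.
have wedge1Z a (x : Om1) : wedge [:: a *: x] = a *: wedge [:: x] by apply: (wedgeZ [::]).
have wedge1D (x y : Om1) : wedge [:: x + y] = wedge [:: x] + wedge [:: y].
  by apply: (wedgeD [::]).
move: w; apply: span_ind => [|a _ _ [x ->] [y ->]|_ [[//|x [|//]] _ ->]].
- by exists 0; rewrite -(scale0r (0 : Om1)) wedge1Z scale0r.
- by exists (a *: x + y); rewrite wedge1D wedge1Z.
- by exists x.
Qed.

Lemma form0_mem (a : A) : (a *: wedge [::] : exterior Om1) \in extpow Om1 0.
Proof. by rewrite rpredZ ?(wedge_extpow [::]). Qed.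

Lemma diff_form0 (a : A) : deRham_diff (a *: wedge [::] : deRham A) = wedge [:: kd a].
Proof. exact: (diff_symbol a [::]). Qed.

Lemma diff_form1 (om : Om1) : deRham_diff (wedge [:: om] : deRham A) = dmul (wedge [::]) om.
Proof.
have kd1 : kd 1 = 0 :> Om1 by have := kdC A 1; rewrite scale1r.
have lmul0l (w : exterior Om1) : lmul 0 w = 0 by rewrite -(scale0r (0 : Om1)) lmulZl scale0r.
have := diffU 1 [:: om]; rewrite /= kd1 lmul0l lmul0r subr0 add0r !scale1r; exact.
Qed.

Lemma deRham_coh0 :
    (forall c : k, c%:A = 0 :> A -> c = 0) ->
    (forall a : A, wedge [:: kd a] = 0 -> exists c : k, a = c%:A) ->
  has_dim (deRham_coh A 0) 1.
Proof.
move=> inj const.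
have cl1 : (wedge [::] : deRham A) \in closed_form 0.
  rewrite inE (wedge_extpow [::]) -[wedge _]scale1r diff_form0 -[1]scale1r kdC.
  by rewrite -(scale0r (0 : Om1)) (wedgeZ [::]) scale0r eqxx.
pose e : closed_forms A 0 := exist (fun w : deRham A => w \in closed_form 0) _ cl1.
pose r (u : 'rV[k]_1) : deRham_coh A 0 := qproj _ (u 0 0 *: e).
have rlin : linear r by move=> a u v; rewrite /r !mxE scalerDl -scalerA linearP.
have rinj u : r u = 0 -> u = 0.
  move/eqP; rewrite qproj_eq0 => /eqP; rewrite linearZ /= => u0.
  apply/rowP => i; rewrite ord1 mxE; apply: inj.
  exact: (@wedge0_inj _ Om1).
have rsurj v : exists u, r u = v.
  rewrite -[v]qprojK; case: (repr v) => z zP.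
  have [a za] : exists a, z = a *: wedge [::] :> exterior Om1.
    by have := zP; rewrite inE => /andP[/form0P].
  have [c ac] : exists c : k, a = c%:A.
    by apply: const; have := zP; rewrite inE za diff_form0 => /andP[_ /eqP].
  exists (const_mx c); rewrite /r mxE; congr qproj.
  by apply/val_inj; rewrite linearZ /= za ac.
have [s sP] := choice rsurj.
have rs : cancel r s.
  move=> u; have : r (-1 *: u + s (r u)) = 0 by rewrite rlin scaleN1r sP addNr.
  by move/rinj/eqP; rewrite scaleN1r addrC subr_eq0 => /eqP.
constructor; exists s; last by exists r.
by move=> a x y; rewrite -[RHS]rs rlin !sP.
Qed.

Lemma deRham_coh1 :
    (forall om : Om1, dmul (wedge [::]) om = 0 -> exists a, om = kd a) ->
  has_dim (deRham_coh A 1) 0.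
Proof.
move=> exact1.
have coh0 (v : deRham_coh A 1) : v = 0.
  rewrite -[v]qprojK; apply/eqP; rewrite qproj_eq0; case: (repr v) => z zP.
  have [om zom] : exists om, z = wedge [:: om] :> exterior Om1.
    by have := zP; rewrite inE => /andP[/form1P].
  have [a oma] : exists a, om = kd a.
    by apply: exact1; have := zP; rewrite inE zom diff_form1 => /andP[_ /eqP].
  apply/asboolP; exists (a *: wedge [::]); first exact: form0_mem.
  by rewrite diff_form0 -oma.
constructor; exists (fun=> 0) => //.
  by move=> a x y; rewrite scaler0 addr0.
by exists (fun=> 0) => x; [rewrite [x]coh0 | apply/rowP => -[]].
Qed.

End LowDegree.

(** * Polynomials in two variables *)

(** Reduces an equation that follows from E : a = b by adding and cancelling
terms to an identity that ring proves. *)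
Lemma eq_of_subr_eq (V : zmodType) (a b c d : V) : a = b -> c - d = a - b -> c = d.
Proof. by move=> ->; rewrite subrr => /subr0_eq. Qed.

(** In {poly {poly k}}, the outer variable is x and the inner one is y. *)
Section PartialDerivatives.
Variable k : comNzRingType.
Local Notation T := {poly {poly k}}.

Definition dX (p : T) : T := p^`().
Definition dY (p : T) : T := map_poly (@deriv k) p.

Lemma coef_dX p i : (dX p)`_i = p`_i.+1 *+ i.+1.
Proof. exact: coef_deriv. Qed.

Lemma coef_dY p i : (dY p)`_i = (p`_i)^`().
Proof. by rewrite coef_map_id0 ?deriv0. Qed.

Fact dX_additive : zmod_morphism dX.
Proof. exact: raddfB. Qed.
HB.instance Definition _ := GRing.isZmodMorphism.Build T T dX dX_additive.

Fact dY_additive : zmod_morphism dY.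
Proof. exact: raddfB. Qed.
HB.instance Definition _ := GRing.isZmodMorphism.Build T T dY dY_additive.

Lemma dXD p q : dX (p + q) = dX p + dX q. Proof. exact: raddfD. Qed.
Lemma dXB p q : dX (p - q) = dX p - dX q. Proof. exact: raddfB. Qed.
Lemma dYD p q : dY (p + q) = dY p + dY q. Proof. exact: raddfD. Qed.
Lemma dYB p q : dY (p - q) = dY p - dY q. Proof. exact: raddfB. Qed.

Lemma dXM p q : dX (p * q) = p * dX q + q * dX p.
Proof. by rewrite /dX derivM addrC [_ * q]mulrC. Qed.

Lemma dYM p q : dY (p * q) = p * dY q + q * dY p.
Proof.
apply/polyP => i; rewrite [q * _]mulrC coefD !coefM coef_dY coefM raddf_sum -big_split /=.
by apply: eq_bigr => j _; rewrite !coef_dY derivM addrC.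
Qed.

Lemma dX_polyC (p : {poly k}) : dX p%:P = 0.
Proof. exact: derivC. Qed.

Lemma dY_polyC (p : {poly k}) : dY p%:P = p^`()%:P.
Proof. exact: map_polyC. Qed.

Lemma dX_X : dX 'X = 1.
Proof. exact: derivX. Qed.

Lemma dY_X : dY 'X = 0.
Proof.
by apply/polyP => i; rewrite coef_dY coefX coef0; case: (i == 1)%N; rewrite ?derivC ?deriv0.
Qed.

Lemma dX_dY p : dX (dY p) = dY (dX p).
Proof. by apply/polyP => i; rewrite !(coef_dX, coef_dY) derivMn. Qed.

End PartialDerivatives.

Section Bivariate.
Variable K : numFieldType.
Local Notation T := {poly {poly K}}.

Lemma natr_poly_unit n : n.+1%:R \is a @GRing.unit {poly K}.
Proof.
by rewrite -polyC_natr poly_unitE size_polyC coefC eqxx unitfE pnatr_eq0.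
Qed.

Lemma antiderivative_ex (S : unitRingType) (p : {poly S}) :
  (forall n, n.+1%:R \is a @GRing.unit S) -> exists f, f^`() = p.
Proof.
move=> nU; exists (\poly_(i < (size p).+1) (p`_i.-1 / i%:R)).
apply/polyP => i; rewrite coef_deriv coef_poly ltnS /=.
case: ltnP => [_|ip]; last by rewrite mul0rn nth_default.
by rewrite -[LHS]mulr_natr divrK.
Qed.

Lemma poly_natmul_eq0 (p : {poly K}) n : (p *+ n == 0) = (n == 0)%N || (p == 0).
Proof.
by rewrite -mulr_natl mulf_eq0 -polyC_natr polyC_eq0 pnatr_eq0.
Qed.

Lemma deriv_eq0 (p : {poly K}) : p^`() = 0 -> exists c, p = c%:P.
Proof.
move=> p0; exists p`_0; apply/polyP => -[|i]; rewrite coefC //=.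
by move/polyP/(_ i)/eqP: p0; rewrite coef_deriv coef0 mulrn_eq0 /= => /eqP.
Qed.

Lemma dX_eq0 (p : T) : dX p = 0 -> exists c, p = c%:P.
Proof.
move=> p0; exists p`_0; apply/polyP => -[|i]; rewrite coefC //=.
by move/polyP/(_ i)/eqP: p0; rewrite coef_dX coef0 poly_natmul_eq0 => /eqP.
Qed.

(** Integrate p in x; what then remains of q depends on y alone. *)
Lemma poincare (p q : T) : dX q = dY p -> exists f, p = dX f /\ q = dY f.
Proof.
move=> qp; have [f1 f1p] := antiderivative_ex p natr_poly_unit.
have [|s sE] := @dX_eq0 (q - dY f1).
  by rewrite raddfB /= dX_dY qp -f1p subrr.
have [r rs] : exists r : {poly K}, r^`() = s.
  by apply: antiderivative_ex => n; rewrite unitfE pnatr_eq0.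
exists (f1 + r%:P); rewrite !raddfD /= dX_polyC addr0 dY_polyC rs -sE.
by split; [rewrite -f1p | rewrite addrC subrK].
Qed.

Lemma half_mixed_partials (d h h' : T) : dX d = 2 * h -> dY d = 2 * h' -> dX h' = dY h.
Proof.
move=> dh dh'; have E : (2 : T) != 0 by rewrite -!polyC_natr !polyC_eq0 pnatr_eq0.
apply: (mulfI E); rewrite !mulr_natl -!raddfMn /= -(mulr_natl h') -(mulr_natl h).
by rewrite -dh -dh' dX_dY.
Qed.

(** * The twisted Poincare lemma *)

Variable m : K.

Definition quadY : {poly K} := 'X^2 - 4.
Definition disc : T := ('X^2 - 4) * quadY%:P - m%:P%:P.
(** Half of the partial derivatives of disc. *)
Definition hdiscX : T := 'X * quadY%:P.
Definition hdiscY : T := ('X)%:P * ('X^2 - 4).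

Lemma discE : disc = ('X^2 - 4) * (('X)%:P ^+ 2 - 4) - m%:P%:P.
Proof. by rewrite /disc /quadY polyCB polyC_natr rmorphXn. Qed.

Lemma hdiscXE : hdiscX = 'X * (('X)%:P ^+ 2 - 4).
Proof. by rewrite /hdiscX /quadY polyCB polyC_natr rmorphXn. Qed.

Lemma hdiscYE : hdiscY = ('X)%:P * ('X^2 - 4).
Proof. by []. Qed.

Lemma dX_disc : dX disc = 2 * hdiscX.
Proof.
have -> : disc = ('X * 'X - 4%:P) * quadY%:P - m%:P%:P.
  by rewrite /disc expr2 polyC_natr.
by rewrite dXB dX_polyC dXM dXB !dX_polyC dXM dX_X /hdiscX; ring.
Qed.

Lemma dY_disc : dY disc = 2 * hdiscY.
Proof.
have -> : disc = ('X * 'X - 4%:P) * (('X)%:P * ('X)%:P - 4%:P) - m%:P%:P.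
  by rewrite /disc /quadY !expr2 !polyCB !polyCM !polyC_natr.
rewrite dYB dYM !dYB !dYM !dY_polyC dY_X derivX derivC /hdiscY.
rewrite !polyC_natr (_ : (4 : {poly K})^`() = 0) ?polyC0; last by rewrite -polyC_natr derivC.
ring.
Qed.

(** sqrt disc times the partial derivatives of g sqrt disc. *)
Definition twistX g := disc * dX g + hdiscX * g.
Definition twistY g := disc * dY g + hdiscY * g.

(** The form (p dx + q dy) / sqrt disc is closed. *)
Definition twist_closed p q := disc * (dX q - dY p) = hdiscX * q - hdiscY * p.

Lemma dX_hdiscY : dX hdiscY = dY hdiscX.
Proof. exact: half_mixed_partials dX_disc dY_disc. Qed.

Lemma twist_closed_exact g : twist_closed (twistX g) (twistY g).
Proof.
rewrite /twist_closed /twistX /twistY dXD dYD (dXM disc) (dXM hdiscY) (dYM disc) (dYM hdiscX).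
rewrite dX_dY dX_disc dY_disc dX_hdiscY.
ring.
Qed.

Lemma twist_closedB p q p' q' :
  twist_closed p q -> twist_closed p' q' -> twist_closed (p - p') (q - q').
Proof.
rewrite /twist_closed dXB dYB => E E'.
have -> : disc * (dX q - dX q' - (dY p - dY p')) =
  disc * (dX q - dY p) - disc * (dX q' - dY p') by ring.
by rewrite E E'; ring.
Qed.

(** Multiplication by disc = quadY x^2 - (4 quadY + m) on coefficients in x. *)
Lemma disc_coef (p : T) j :
  (disc * p)`_j = quadY * (if j is i.+2 then p`_i else 0) - (4 * quadY + m%:P) * p`_j.
Proof.
have -> : disc * p = quadY%:P * (p * 'X^2) - (4 * quadY + m%:P)%:P * p.
  by rewrite /disc (polyCD (4 * quadY)) (polyCM 4) polyC_natr; ring.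
rewrite coefB !coefCM coefMXn; case: j => [|[|j]] //=.
by rewrite subn2.
Qed.

Lemma hdiscX_coef (p : T) j : (hdiscX * p)`_j = quadY * (if j is i.+1 then p`_i else 0).
Proof.
have -> : hdiscX * p = quadY%:P * (p * 'X) by rewrite /hdiscX; ring.
by rewrite coefCM coefMX; case: j.
Qed.

Lemma hdiscY_coef (p : T) j :
  (hdiscY * p)`_j = 'X * ((if j is i.+2 then p`_i else 0) - 4 * p`_j).
Proof.
have -> : hdiscY * p = ('X)%:P * (p * 'X^2 - 4%:P * p) by rewrite /hdiscY -polyC_natr; ring.
rewrite coefCM coefB coefCM coefMXn; case: j => [|[|j]] //=.
by rewrite subn2.
Qed.

Lemma twistX_coef g j : (twistX g)`_j.+1 =
  quadY * g`_j *+ j.+1 - (4 * quadY + m%:P) * g`_j.+2 *+ j.+2.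
Proof.
rewrite /twistX coefD disc_coef hdiscX_coef !coef_dX.
by case: j => [|j]; rewrite ?coef_dX; ring.
Qed.

Lemma quadY_neq0 : quadY != 0.
Proof. by rewrite -size_poly_eq0 /quadY -polyC_natr size_XnsubC. Qed.

Lemma size_lead_neq0 (S : nzRingType) (p : {poly S}) :
  p != 0 -> exists2 n, size p = n.+1 & p`_n != 0.
Proof.
move=> p0; have := p0; rewrite -lead_coef_eq0 /lead_coef.
by rewrite -size_poly_eq0 in p0; case: (size p) p0 => // n _ pn; exists n.
Qed.

(** The coefficient of twistX g following the leading one of g, of degree n in
x, is (n + 1) quadY times that leading coefficient. *)
Lemma twistX_eq0 g : twistX g = 0 -> g = 0.
Proof.
move=> g0; apply: contraTeq isT => /size_lead_neq0[n sg gn].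
have : (twistX g)`_n.+1 = 0 by rewrite g0 coef0.
rewrite twistX_coef [g`_n.+2]nth_default ?sg // mulr0 mul0rn subr0.
by move/eqP; rewrite poly_natmul_eq0 mulf_eq0 (negPf quadY_neq0) (negPf gn).
Qed.

Lemma twist_closed_coef p q j : twist_closed p q ->
  quadY * q`_j.+1 *+ j = quadY * (p`_j)^`() - 'X * p`_j
    + (4 * quadY + m%:P) * (q`_j.+3 *+ j.+3 - (p`_j.+2)^`()) + 4 * 'X * p`_j.+2.
Proof.
move/(congr1 (fun r : T => r`_j.+2)); rewrite disc_coef !coefB hdiscX_coef hdiscY_coef.
rewrite !coef_dX !coef_dY => E.
by apply: (eq_of_subr_eq E); ring.
Qed.

(** y and y^2 - 4 are coprime: 4 = y * y - quadY. *)
Lemma dvd_quadY (r s : {poly K}) : 'X * r = quadY * s -> exists t, r = quadY * t.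
Proof.
move=> rs; exists ((4^-1)%:P * ('X * s - r)).
have c4 : (4^-1)%:P * 4 = 1 :> {poly K}.
  by rewrite -polyC_natr -polyCM mulVf ?pnatr_eq0 // polyC1.
have E : 4 * r = quadY * ('X * s - r).
  have -> : 4 * r = 'X * ('X * r) - quadY * r by rewrite /quadY; ring.
  by rewrite rs; ring.
rewrite -[LHS]mul1r -c4 -mulrA E; ring.
Qed.

(** The equation is that of sqrt quadY. If r = quadY t, then
quadY t' = - y t, so that the degree n of t satisfies n = -1. *)
Lemma sqrt_quadY_irrational r : quadY * r^`() = 'X * r -> r = 0.
Proof.
move=> rE; have [t rt] := dvd_quadY (esym rE).
suff t0 : t = 0 by rewrite rt t0 mulr0.
apply: contraTeq isT => /size_lead_neq0[n st tn].
have E : quadY * t^`() = - ('X * t).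
  have dquadY : quadY^`() = 'X *+ 2 by rewrite /quadY derivB derivXn -polyC_natr derivC subr0.
  apply: (mulfI quadY_neq0); apply: (eq_of_subr_eq rE); rewrite rt derivM dquadY; ring.
move/(congr1 (fun u : {poly K} => u`_n.+1)): E.
have -> : quadY * t^`() = t^`() * 'X^2 - 4%:P * t^`() by rewrite /quadY -polyC_natr; ring.
rewrite coefN coefB coefCM coefMXn coefXM !coef_deriv /= [t`_n.+2]nth_default ?st //.
rewrite mul0rn mulr0 subr0 => /eqP; rewrite -subr_eq0 opprK.
case: n st tn => [|n] st tn /=; first by rewrite add0r (negPf tn).
by rewrite subn2 /= -mulrSr -mulr_natl mulf_eq0 pnatr_eq0 (negPf tn).
Qed.

(** Compares coefficients in x. Beyond those of p, j quadY times the coefficient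
of q in degree j + 1 is a multiple of the one in degree j + 3, so that the
degree of q is at most N + 1. *)
Lemma twist_closed_lead p q N : twist_closed p q -> (size p <= N.+1)%N ->
  (size q <= N.+2)%N /\ quadY * q`_N.+1 *+ N = quadY * (p`_N)^`() - 'X * p`_N.
Proof.
move=> pq sp; have p0 j : (N < j)%N -> p`_j = 0.
  by move=> Nj; rewrite nth_default // (leq_trans sp).
have sq : (size q <= N.+2)%N.
  rewrite leqNgt; apply/negP => Nq.
  have [|n sn qn] := @size_lead_neq0 _ q; first by rewrite -size_poly_eq0 -lt0n (leq_trans _ Nq).
  move: Nq; rewrite sn ltnS => Nn; case: n sn qn Nn => // n sn qn; rewrite ltnS => Nn.
  have := twist_closed_coef n pq; rewrite !p0 ?[q`_n.+3]nth_default ?sn ?ltnS //.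
    rewrite !deriv0 !mulr0 subr0 mul0rn subr0 mulr0 !addr0 => /eqP.
    rewrite poly_natmul_eq0 mulf_eq0 (negPf quadY_neq0) (negPf qn) orbF.
    by case: n Nn {sn qn}.
  exact: leqW (ltnW Nn).
split=> //; rewrite (twist_closed_coef N pq) (p0 N.+2) // [q`_N.+3]nth_default;
  last exact: leq_trans sq _.
by rewrite deriv0 mul0rn subr0 !mulr0 !addr0.
Qed.

Lemma four_quadY_neq0 : 4 * quadY + m%:P != 0.
Proof.
apply/eqP => /(congr1 (fun u : {poly K} => u`_2)).
rewrite /quadY -polyC_natr coefD coefCM coefB coefXn !coefC /= subr0 addr0 mulr1.
by move/eqP; rewrite pnatr_eq0.
Qed.

(** Induction on the degree of p in x. By twist_closed_lead and dvd_quadY, the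
leading coefficient of p is quadY t; subtracting twistX g and twistY g for
g = t x^N / (N + 1) removes it. When p depends on y alone, it is 0 by
sqrt_quadY_irrational, and then so is q. *)
Lemma twisted_poincare p q : twist_closed p q -> exists g, p = twistX g /\ q = twistY g.
Proof.
have [N] : exists N, (size p <= N.+1)%N by exists (size p).
elim: N p q => [|N IH] p q sp pq.
  have [sq] := twist_closed_lead pq sp; rewrite mulr0n => /esym/subr0_eq/sqrt_quadY_irrational p0.
  have {sp}p0 : p = 0.
    by apply/polyP => -[|j]; rewrite ?p0 ?coef0 // nth_default // (leq_trans sp).
  rewrite p0 in pq *; exists 0; rewrite /twistX /twistY !raddf0 !mulr0 !addr0; split=> //.
  have E j := congr1 (fun u : T => u`_j) pq; rewrite /= in E.
  have q2 : q`_2 = 0 by rewrite nth_default.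
  have q1 : q`_1 = 0.
    apply/eqP; rewrite -(mulIr_eq0 _ (mulIf four_quadY_neq0)) -oppr_eq0; apply/eqP.
    have := E 0%N; rewrite disc_coef !coefB hdiscX_coef hdiscY_coef !coef_dX !coef_dY.
    rewrite !coef0 deriv0.
    by move=> E0; apply: (eq_of_subr_eq E0); ring.
  have q0 : q`_0 = 0.
    apply/eqP; rewrite -(mulIr_eq0 _ (mulIf quadY_neq0)) -oppr_eq0; apply/eqP.
    have := E 1%N; rewrite disc_coef !coefB hdiscX_coef hdiscY_coef !coef_dX !coef_dY.
    rewrite !coef0 deriv0 q2.
    by move=> E1; apply: (eq_of_subr_eq E1); ring.
  apply/polyP => -[|[|j]]; rewrite coef0 // nth_default // (leq_trans sq) //.
have [_ lead] := twist_closed_lead pq sp.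
have [|t pt] := @dvd_quadY p`_N.+1 ((p`_N.+1)^`() - q`_N.+2 *+ N.+1).
  by apply: (eq_of_subr_eq lead); ring.
pose g := ((N.+1%:R^-1)%:P * t)%:P * 'X^N : T.
have cN : N.+1%:R * (N.+1%:R^-1)%:P = 1 :> {poly K}.
  by rewrite -polyC_natr -polyCM mulfV ?pnatr_eq0 // polyC1.
have gE j : g`_j = if j == N then (N.+1%:R^-1)%:P * t else 0.
  by rewrite coefCM coefXn; case: eqP => _; rewrite ?mulr1 ?mulr0.
have [||h [hp hq]] := IH (p - twistX g) (q - twistY g).
- apply/leq_sizeP => -[//|j]; rewrite ltnS leq_eqVlt coefB twistX_coef !gE => /orP[/eqP<-|Nj].
    rewrite eqxx gtn_eqF // mulr0 mul0rn subr0 pt; move: (_%:P) cN => u cN.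
    by apply: (eq_of_subr_eq (congr1 ( *%R (quadY * t)) (esym cN))); ring.
  rewrite !gtn_eqF // ?(ltn_trans Nj) // !mulr0 !mul0rn !subr0.
  by rewrite nth_default // (leq_trans sp).
- exact: twist_closedB pq (twist_closed_exact g).
exists (h + g).
by rewrite -[q](subrK (twistY g)) -[p](subrK (twistX g)) hp hq /twistX /twistY dXD dYD; split; ring.
Qed.

Lemma disc_neq0 : disc != 0.
Proof.
apply/eqP => D0; have /negP[] := quadY_neq0; apply/eqP.
have := disc_coef 1 2; rewrite mulr1 D0 coef0 !coefC /= mulr1 mulr0 subr0.
by [].
Qed.

(** Modulo disc, hdiscX and hdiscY, (x^2 - 4) (y^2 - 4) is m and also
- 4 (x^2 - 4) and - 4 (y^2 - 4), so that m^2 = 16 m. *)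
Lemma disc_smooth : m != 0 -> m != 16 ->
  exists u v t : T, u * disc + v * hdiscX + t * hdiscY = 1.
Proof.
move=> m0 m16; have c0 : m * (m - 16) != 0 by rewrite mulf_neq0 ?subr_eq0.
pose c : T := ((m * (m - 16))^-1)%:P%:P.
exists (c * (16 - 2 * m%:P%:P + 'X * hdiscX + ('X)%:P * hdiscY - disc)),
  (c * ('X * (m%:P%:P - ('X)%:P * hdiscY))), (c * (('X)%:P * m%:P%:P)).
have c1 : c * (m%:P%:P * (m%:P%:P - 16)) = 1.
  have -> : 16 = (16 : K)%:P%:P :> T by rewrite !polyC_natr.
  by rewrite /c -!polyCB -!polyCM mulVf.
apply: etrans c1; rewrite discE hdiscXE hdiscYE; ring.
Qed.

End Bivariate.

(** * Double covers of the plane *)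

Lemma relation_multiple (S : pzRingType) (M : lmodType S) (u v z : M) p q r l a b c :
    r *: z = p *: u + q *: v -> a = l * p -> b = l * q -> c = - (l * r) ->
  a *: u + b *: v + c *: z = 0.
Proof. by move=> E -> -> ->; rewrite scaleNr -!scalerA E -scalerDr addrN. Qed.

(** Here w^2 = D on A = T + T w, and hX and hY are half of the partial
derivatives of D. *)
Section CotangentModule.
Variables (k : comNzRingType) (A : comAlgType k).
Local Notation T := {poly {poly k}}.
Variables D hX hY : T.
Hypothesis dX_D : dX D = 2 * hX.
Hypothesis dY_D : dY D = 2 * hY.
Hypothesis D_smooth : exists u v t : T, u * D + v * hX + t * hY = 1.
Variables (ev : {rmorphism T -> A}) (w : A).
Hypothesis evC : forall c, ev c%:P%:P = c%:A.
Hypothesis w_sqr : w * w = ev D.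
Hypothesis gen : forall a, exists fg : T * T, a = ev fg.1 + ev fg.2 * w.
Hypothesis w_reg : forall a, w * a = 0 -> a = 0.
Hypothesis half_ex : exists h : A, h * 2 = 1.

Local Notation x := (ev 'X).
Local Notation y := (ev ('X)%:P).

Lemma kd_ev f : kd (ev f) = ev (dX f) *: kd x + ev (dY f) *: kd y.
Proof.
elim/poly_ind: f => [|p c IHp]; first by rewrite !raddf0 !scale0r addr0.
have Ec : kd (ev c%:P) = ev (c^`())%:P *: kd y.
  elim/poly_ind: c => [|q c IHq]; first by rewrite deriv0 !raddf0 scale0r.
  rewrite polyCD polyCM rmorphD rmorphM raddfD /= evC kdC addr0 kdM IHq.
  rewrite derivD derivM derivX derivC addr0 mulr1 polyCD polyCM rmorphD rmorphM.
  by rewrite scalerA -scalerDl; congr (_ *: _); ring.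
rewrite rmorphD rmorphM raddfD /= kdM IHp Ec dXD dYD dXM dYM dX_X dY_X dX_polyC dY_polyC.
rewrite scalerDr !scalerA addrA -scalerDl -addrA -scalerDl.
by congr (_ *: _ + _ *: _); rewrite !(rmorphD, rmorphM, rmorph0, rmorph1); ring.
Qed.

Lemma kaehler_gen (om : kaehler A) :
  exists a b c, om = a *: kd x + b *: kd y + c *: kd w.
Proof.
elim/kaehler_ind: om => [om1 om2 [a [b [c ->]]] [a' [b' [c' ->]]]|e f].
  by exists (a + a'), (b + b'), (c + c'); rewrite !scalerDl addrACA [X in X + _]addrACA.
have [[p q] ->] := gen f; rewrite /= raddfD /= kdM (kd_ev p) (kd_ev q).
exists (e * (ev (dX p) + w * ev (dX q))), (e * (ev (dY p) + w * ev (dY q))), (e * ev q).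
rewrite !scalerDr !scalerA !mulrDr !scalerDl !mulrA.
by rewrite [X in _ + X]addrC addrA (addrACA (_ *: kd x)).
Qed.

Lemma kd_disc : w *: kd w = ev hX *: kd x + ev hY *: kd y.
Proof.
have [h two] := half_ex.
have half (v : kaehler A) : h *: (2 *: v) = v by rewrite scalerA two scale1r.
rewrite -[LHS]half -[RHS]half; congr (_ *: _).
rewrite scaler_nat mulr2n -kdM w_sqr (kd_ev D) dX_D dY_D !rmorphM !rmorph_nat.
by rewrite -!scalerA -scalerDr.
Qed.

Lemma kd_disc_multiple l a b c : a = l * ev hX -> b = l * ev hY -> c = - (l * w) ->
  a *: kd x + b *: kd y + c *: kd w = 0.
Proof. exact: (relation_multiple kd_disc). Qed.

(** om is a combination of D om = w (w om), hX om and hY om. *)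
Lemma unimodular (om : kaehler A) : w *: om = 0 -> ev hX *: om = 0 -> ev hY *: om = 0 -> om = 0.
Proof.
move=> w0 x0 y0.
have [u [v [t E]]] := D_smooth.
rewrite -[om]scale1r -(rmorph1 ev) -E !rmorphD !rmorphM /= -w_sqr !scalerDl -!scalerA.
by rewrite w0 x0 y0 !scaler0 !addr0.
Qed.

(** For om = a dx + b dy + c dw, the hypotheses are a w + c hX = 0 and
b w + c hY = 0. With the relation w dw = hX dx + hY dy they kill w om, hX om
and hY om. *)
Lemma contractions_inj (i1 i2 : {scalar kaehler A}) (om : kaehler A) :
    i1 (kd x) = w -> i1 (kd y) = 0 -> i1 (kd w) = ev hX ->
    i2 (kd x) = 0 -> i2 (kd y) = w -> i2 (kd w) = ev hY ->
  i1 om = 0 -> i2 om = 0 -> om = 0.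
Proof.
move=> i1x i1y i1w i2x i2y i2w.
have [a [b [c ->]]] := kaehler_gen om.
rewrite !raddfD /= !linearZ /= i1x i1y i1w i2x i2y i2w !mulr0 addr0 add0r => E1 E2.
have E3 : b * ev hX = a * ev hY.
  apply/subr0_eq/w_reg; apply: (eq_of_subr_eq (a := ev hX * (b * w + c * ev hY)
    - ev hY * (a * w + c * ev hX)) (b := 0)); last ring.
  by rewrite E1 E2 !mulr0 subrr.
apply: unimodular; rewrite !scalerDr !scalerA.
- apply: (@kd_disc_multiple (- c)); last ring.
    by apply: (eq_of_subr_eq E1); ring.
  by apply: (eq_of_subr_eq E2); ring.
- apply: (@kd_disc_multiple a); first ring.
    by rewrite -E3 mulrC.
  by apply: (eq_of_subr_eq E1); ring.
- apply: (@kd_disc_multiple b); last by apply: (eq_of_subr_eq E2); ring.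
    by rewrite E3 mulrC.
  ring.
Qed.

(** The value of d om on the pair of vector fields d1, d2 is the left-hand side of
the last equation. *)
Lemma closed_form1_eq (d1 d2 : A -> A) (i1 i2 : {scalar kaehler A}) (om : kaehler A) :
    (forall a, i1 (kd a) = d1 a) -> (forall a, i2 (kd a) = d2 a) ->
    d1 x = w -> d1 y = 0 -> d1 w = ev hX -> d2 x = 0 -> d2 y = w -> d2 w = ev hY ->
  dmul (wedge [::]) om = 0 ->
  exists a b c, [/\ i1 om = a * w + c * ev hX, i2 om = b * w + c * ev hY &
    d1 b * w - d2 a * w + (d1 c * ev hY - d2 c * ev hX) = 0].
Proof.
move=> i1E i2E d1x d1y d1w d2x d2y d2w closed.
have [tau tauE] := ext_form2 i1 i2; have [a [b [c omE]]] := kaehler_gen om.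
exists a, b, c; split.
- by rewrite omE !raddfD /= !linearZ /= !i1E d1x d1y d1w mulr0 addr0.
- by rewrite omE !raddfD /= !linearZ /= !i2E d2x d2y d2w mulr0 add0r.
have := congr1 tau closed; rewrite omE !raddfD /= !dmulU !lmul_wedge !tauE !i1E !i2E.
rewrite d1x d1y d1w d2x d2y d2w raddf0 => E; apply: (eq_of_subr_eq E); ring.
Qed.

End CotangentModule.

Section DoublePlane.
Variables (K : numFieldType) (A : comAlgType K).
Local Notation T := {poly {poly K}}.
Variables D hX hY : T.
Hypothesis dX_D : dX D = 2 * hX.
Hypothesis dY_D : dY D = 2 * hY.
Hypothesis D_neq0 : D != 0.
Hypothesis D_smooth : exists u v t : T, u * D + v * hX + t * hY = 1.
Hypothesis twisted_poincare : forall p q, D * (dX q - dY p) = hX * q - hY * p ->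
  exists g, p = D * dX g + hX * g /\ q = D * dY g + hY * g.
Hypothesis twisted_const : forall g, D * dX g + hX * g = 0 -> g = 0.

Variables (ev : {rmorphism T -> A}) (w : A).
Hypothesis evC : forall c, ev c%:P%:P = c%:A.
Hypothesis w_sqr : w * w = ev D.
Hypothesis gen : forall a, exists fg : T * T, a = ev fg.1 + ev fg.2 * w.
Hypothesis free : forall f g, ev f + ev g * w = 0 -> f = 0 /\ g = 0.

Lemma ev_inj2 f g f' g' : ev f + ev g * w = ev f' + ev g' * w -> f = f' /\ g = g'.
Proof.
move=> E; have [|/subr0_eq-> /subr0_eq->//] := @free (f - f') (g - g').
by rewrite !rmorphB; apply: (eq_of_subr_eq E); ring.
Qed.

Lemma w_reg a : w * a = 0 -> a = 0.
Proof.
have [[f g] ->] := gen a => /= E.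
have [|gD f0] := @free (g * D) f.
  by rewrite rmorphM -w_sqr -[RHS]E; ring.
move/eqP: gD; rewrite mulf_eq0 (negPf D_neq0) orbF f0 => /eqP->.
by rewrite rmorph0 mul0r addr0.
Qed.

Section Lift.
Variables (del : {additive T -> T}) (h : T).
Hypothesis delM : forall p q, del (p * q) = p * del q + q * del p.
Hypothesis delC : forall c : K, del c%:P%:P = 0.
Hypothesis delD : del D = 2 * h.

(** The vector field w del, with w del(w) = del(D) / 2 = h. *)
Lemma derivation_ex : exists d : {additive A -> A},
  [/\ forall a b, d (a * b) = a * d b + b * d a, forall c : K, d c%:A = 0 &
      forall f g, d (ev f + ev g * w) = ev (del f) * w + ev (D * del g + h * g)].
Proof.
have [c cE] := choice gen.
pose d a := ev (del (c a).1) * w + ev (D * del (c a).2 + h * (c a).2).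
have dE f g : d (ev f + ev g * w) = ev (del f) * w + ev (D * del g + h * g).
  by rewrite /d; have [<- <-] := ev_inj2 (cE (ev f + ev g * w)).
have dA : zmod_morphism d.
  move=> a b; have [[f g] ->] := gen a; have [[f' g'] ->] /= := gen b.
  have -> : ev f + ev g * w - (ev f' + ev g' * w) = ev (f - f') + ev (g - g') * w.
    by rewrite !rmorphB; ring.
  by rewrite !dE !raddfB /= !(rmorphB, rmorphD, rmorphM); ring.
pose dd : {additive A -> A} := HB.pack d (GRing.isZmodMorphism.Build A A d dA).
exists dd; split=> //.
  move=> a b; have [[f g] ->] := gen a; have [[f' g'] ->] /= := gen b.
  have -> : (ev f + ev g * w) * (ev f' + ev g' * w)
      = ev (f * f' + g * g' * D) + ev (f * g' + g * f') * w.
    by rewrite !(rmorphD, rmorphM) -w_sqr; ring.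
  rewrite !dE !raddfD /= !delM delD !(rmorphD, rmorphM) /= -w_sqr; ring.
move=> t; have := dE t%:P%:P 0; rewrite rmorph0 mul0r addr0 evC /= => ->.
by rewrite delC !raddf0 !mulr0 mul0r !add0r raddf0.
Qed.
End Lift.

Local Notation x := (ev 'X).
Local Notation y := (ev ('X)%:P).

(** Separates the even and odd parts of the contractions of a form with
d1 = w d/dx and d2 = w d/dy: the odd parts are ruled by poincare, the even ones
by the twisted Poincare lemma. *)
Lemma closed_exact_double_plane :
    (forall om : kaehler A, dmul (wedge [::]) om = 0 -> exists a, om = kd a) /\
    (forall a : A, wedge [:: kd a] = 0 -> exists c : K, a = c%:A).
Proof.
have dXC0 c : dX c%:P%:P = 0 :> T by rewrite dX_polyC.
have dYC0 c : dY c%:P%:P = 0 :> T by rewrite dY_polyC derivC.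
have [d1 [d1M d1C d1E]] := derivation_ex (@dXM K) dXC0 dX_D.
have [d2 [d2M d2C d2E]] := derivation_ex (@dYM K) dYC0 dY_D.
have [i1 i1E] := contraction_ex d1M d1C.
have [i2 i2E] := contraction_ex d2M d2C.
have evE f : ev f = ev f + ev 0 * w by rewrite rmorph0 mul0r addr0.
have wE : w = ev 0 + ev 1 * w by rewrite rmorph0 rmorph1 mul1r add0r.
have d1ev f : d1 (ev f) = ev (dX f) * w.
  by rewrite {1}[ev f]evE d1E raddf0 !mulr0 addr0 rmorph0 addr0.
have d2ev f : d2 (ev f) = ev (dY f) * w.
  by rewrite {1}[ev f]evE d2E raddf0 !mulr0 addr0 rmorph0 addr0.
have dX1 : dX 1 = 0 :> T by rewrite -polyC1 dX_polyC.
have dY1 : dY 1 = 0 :> T by rewrite -polyC1 dY_polyC -polyC1 derivC.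
have d1w : d1 w = ev hX.
  by rewrite {1}wE d1E /= dX1 !(raddf0, mulr0, mul0r, add0r, mulr1).
have d2w : d2 w = ev hY.
  by rewrite {1}wE d2E /= dY1 !(raddf0, mulr0, mul0r, add0r, mulr1).
have d1x : d1 x = w by rewrite d1ev dX_X rmorph1 mul1r.
have d1y : d1 y = 0 by rewrite d1ev dX_polyC rmorph0 mul0r.
have d2x : d2 x = 0 by rewrite d2ev dY_X rmorph0 mul0r.
have d2y : d2 y = w by rewrite d2ev dY_polyC derivX rmorph1 mul1r.
have half_ex : exists h : A, h * 2 = 1.
  exists (2^-1)%:A.
  by rewrite mulr_natr scalerMnl -mulr_natr mulVf ?pnatr_eq0 // scale1r.
have inj om : i1 om = 0 -> i2 om = 0 -> om = 0.
  by apply: (contractions_inj dX_D dY_D D_smooth evC w_sqr gen w_reg half_ex);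
    rewrite ?i1E ?i2E.
split=> [om closed|a a0]; last first.
  have [tau1 tau1E] := ext_form1 i1; have [tau2 tau2E] := ext_form1 i2.
  have := congr1 tau1 a0; have := congr1 tau2 a0.
  rewrite tau1E tau2E !raddf0 i1E i2E; have [[f g] ->] := gen a.
  rewrite /= d1E d2E /= [X in X = 0 -> _]addrC [X in _ -> X = 0 -> _]addrC.
  move=> /free[_ fY] /free[/twisted_const-> fX].
  have [r fr] := dX_eq0 fX; move: fY; rewrite fr dY_polyC => /eqP.
  rewrite polyC_eq0 => /eqP/deriv_eq0[c ->].
  by exists c; rewrite rmorph0 mul0r addr0 evC.
have hXY := half_mixed_partials dX_D dY_D.
have [a [b [c [PE' QE' Ecl]]]] :=
  closed_form1_eq evC gen i1E i2E d1x d1y d1w d2x d2y d2w closed.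
have [[P0 P1] PE] := gen (i1 om); have [[Q0 Q1] QE] := gen (i2 om).
rewrite /= in PE QE.
(* This is d (w om) = dw /\ om, for a closed form om, evaluated on d1 and d2. *)
have key : w * (d1 (i2 om) - d2 (i1 om)) = ev hX * i2 om - ev hY * i1 om.
  rewrite QE' PE' !raddfD /= !d1M !d2M !d1ev !d2ev d1w d2w hXY.
  apply: (eq_of_subr_eq (congr1 ( *%R w) Ecl)); ring.
move: key; rewrite QE PE d1E d2E => key.
have [|C0 C1] := @ev_inj2 (D * (dX Q0 - dY P0)) (D * dX Q1 + hX * Q1 - (D * dY P1 + hY * P1))
    (hX * Q0 - hY * P0) (hX * Q1 - hY * P1).
  rewrite !(rmorphB, rmorphD, rmorphM) /= -w_sqr.
  rewrite !(rmorphD, rmorphM) /= -w_sqr in key.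
  apply: (eq_of_subr_eq key); ring.
have [f [P1f Q1f]] : exists f, P1 = dX f /\ Q1 = dY f.
  apply: poincare; apply: (mulfI D_neq0); apply: (eq_of_subr_eq C1); ring.
have [g [P0g Q0g]] := twisted_poincare C0.
exists (ev f + ev g * w); apply/subr0_eq/inj; rewrite raddfB /= ?i1E ?i2E.
  by rewrite PE d1E /= -P0g -P1f [X in _ - X]addrC subrr.
by rewrite QE d2E /= -Q0g -Q1f [X in _ - X]addrC subrr.
Qed.

End DoublePlane.

(** * The cubic surface as a double cover *)

Section MarkovCubic.
Variables (K : numFieldType) (b : K).
Local Notation P := {mpoly K[3]}.
Local Notation T := {poly {poly K}}.

(** The embedding of K[y][x] into K[x_0, x_1, x_2], with x = x_0 and y = x_1. *)
Definition plane_poly : {rmorphism T -> P} :=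
  (horner_eval ('X_0 : P) \o map_poly (horner_eval ('X_1 : P) \o map_poly (@mpolyC 3 K)))%FUN.

Lemma plane_polyC c : plane_poly c%:P%:P = c%:MP.
Proof. by rewrite /plane_poly /= map_polyC /= map_polyC /= /horner_eval !hornerC. Qed.

Lemma plane_polyX : plane_poly 'X = 'X_0.
Proof. by rewrite /plane_poly /= map_polyX /horner_eval hornerX. Qed.

Lemma plane_polyY : plane_poly ('X)%:P = 'X_1.
Proof. by rewrite /plane_poly /= map_polyC /= map_polyX /horner_eval hornerC hornerX. Qed.

(** Polynomials in x_2 over K[y][x], where the equation of the surface is monic. *)
Lemma proj_poly_ex : exists psi : {rmorphism P -> {poly T}},
  [/\ forall c, psi c%:MP = c%:P%:P%:P, psi 'X_0 = ('X)%:P, psi 'X_1 = ('X)%:P%:P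
    & psi 'X_2 = 'X].
Proof.
exists (mmap (polyC \o (polyC \o polyC)) (fun i : 'I_3 =>
  if i == 0 then ('X)%:P else if i == 1 then ('X)%:P%:P else 'X)).
by split=> [c|||] /=; rewrite ?mmapC // mmapX mmap1U.
Qed.

Lemma morph_plane_poly (S : comNzRingType) (psi : {rmorphism P -> S}) (phi : {rmorphism T -> S}) :
    (forall c, psi c%:MP = phi c%:P%:P) -> psi 'X_0 = phi 'X -> psi 'X_1 = phi ('X)%:P ->
  forall f, psi (plane_poly f) = phi f.
Proof.
move=> psiC psi0 psi1.
elim/poly_ind=> [|p c IHp]; first by rewrite !rmorph0.
have Ec : psi (plane_poly c%:P) = phi c%:P.
  elim/poly_ind: c => [|q c IHq]; first by rewrite !rmorph0.
  rewrite !polyCD !polyCM !(rmorphD plane_poly) !(rmorphM plane_poly) !rmorphD !rmorphM IHq.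
  by rewrite plane_polyC plane_polyY psiC psi1.
rewrite !(rmorphD plane_poly) !(rmorphM plane_poly) !rmorphD !rmorphM IHp plane_polyX.
by rewrite Ec psi0.
Qed.

Variables (A : comAlgType K) (pi : {rmorphism P -> A}).
Hypothesis piC : forall c, pi c%:MP = c%:A.
Hypothesis pi_surj : forall a, exists p, pi p = a.

Definition markov : P :=
  let x1 := 'X_0 in let x2 := 'X_1 in let x3 := 'X_2 in
  - 2 + x1 ^+ 2 + x2 ^+ 2 + x3 ^+ 2 - x1 * x2 * x3 - b%:MP.
Hypothesis pi_ker : forall p, pi p = 0 <-> exists q, p = q * markov.

Definition coord_ev : {rmorphism T -> A} := pi \o plane_poly.
Definition coord_w : A := pi (2 * 'X_2 - 'X_0 * 'X_1).
Definition branch : T := disc (8 - 4 * b).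

Lemma coord_evE f : coord_ev f = pi (plane_poly f).
Proof. by []. Qed.

Lemma coord_evC c : coord_ev c%:P%:P = c%:A.
Proof. by rewrite coord_evE plane_polyC. Qed.

Lemma coord_evX : coord_ev 'X = pi 'X_0.
Proof. by rewrite coord_evE plane_polyX. Qed.

Lemma coord_evY : coord_ev ('X)%:P = pi 'X_1.
Proof. by rewrite coord_evE plane_polyY. Qed.

Lemma coord_w_sqr : coord_w * coord_w = coord_ev branch.
Proof.
apply/subr0_eq; rewrite coord_evE /coord_w -rmorphM -rmorphB; apply/pi_ker; exists 4.
have E : plane_poly branch = ('X_0 ^+ 2 - 4) * ('X_1 ^+ 2 - 4) - (8 - 4 * b)%:MP.
  rewrite /branch discE !(rmorphB plane_poly) (rmorphM plane_poly) !(rmorphB plane_poly).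
  by rewrite !(rmorphXn plane_poly) !(rmorph_nat plane_poly) plane_polyX plane_polyY plane_polyC.
rewrite E /markov mpolyCB mpolyCM !mpolyC_nat; ring.
Qed.

Lemma coord_gen a : exists fg : T * T, a = coord_ev fg.1 + coord_ev fg.2 * coord_w.
Proof.
pose S (p : P) := exists f g, pi p = coord_ev f + coord_ev g * coord_w.
have SM p q : S p -> S q -> S (p * q).
  move=> [f [g E]] [f' [g' E']].
  exists (f * f' + g * g' * branch), (f * g' + g * f').
  rewrite (rmorphM pi) E E' !(rmorphD coord_ev) !(rmorphM coord_ev) -coord_w_sqr; ring.
have SD p q : S p -> S q -> S (p + q).
  move=> [f [g E]] [f' [g' E']]; exists (f + f'), (g + g').
  by rewrite (rmorphD pi) E E' !(rmorphD coord_ev); ring.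
have SC c : S c%:MP.
  by exists c%:P%:P, 0; rewrite rmorph0 mul0r addr0 coord_evC piC.
have S0 : S 'X_0.
  by exists 'X, 0; rewrite rmorph0 mul0r addr0 coord_evX.
have S1 : S 'X_1.
  by exists ('X)%:P, 0; rewrite rmorph0 mul0r addr0 coord_evY.
have S2 : S 'X_2.
  suff -> : 'X_2 = (2^-1)%:MP * ((2 * 'X_2 - 'X_0 * 'X_1) + 'X_0 * 'X_1) :> P.
    apply: (SM) => //; apply: SD; last exact: (SM).
    by exists 0, 1; rewrite rmorph0 rmorph1 mul1r add0r.
  by rewrite subrK -mpolyC_nat mulrA -mpolyCM mulVf ?pnatr_eq0 // mpolyC1 mul1r.
have SX (i : 'I_3) : S 'X_i.
  case: i => [[|[|[|//]]] lti]; [move: S0 | move: S1 | move: S2];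
    by congr S; congr 'X_ _; exact: val_inj.
have [p <-] : exists p, pi p = a by exact: pi_surj.
suff [f [g ->]] : S p by exists (f, g).
elim/mpolyind: p => [|c m p _ _ Sp]; first exact: (SC 0).
apply: (SD) => //; rewrite -mul_mpolyC mpolyXE_id; apply: (SM) => //.
elim/big_ind: _ => [|//|i _]; first exact: (SC 1).
elim: (m i) => [|n IHn]; first exact: (SC 1).
by rewrite exprS; apply: (SM).
Qed.

(** As a polynomial in x_2, a multiple of the equation of the surface has degree
at least 2 or is 0. *)
Lemma coord_free f g : coord_ev f + coord_ev g * coord_w = 0 -> f = 0 /\ g = 0.
Proof.
rewrite !coord_evE /coord_w -rmorphM -rmorphD => /pi_ker[q].
have [psi [psiC psi0 psi1 psi2]] := proj_poly_ex.
move/(congr1 psi); rewrite rmorphD !rmorphM !(@morph_plane_poly _ psi polyC) //.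
have [u uE] : exists u : T, u = 'X by exists 'X.
have [v vE] : exists v : T, v = ('X)%:P by exists ('X)%:P.
have -> : psi markov = 'X^2 + ((- (u * v))%:P * 'X
    + (u ^+ 2 + v ^+ 2 - 2 - b%:P%:P)%:P).
  have -> : psi markov = - 2 + psi 'X_0 ^+ 2 + psi 'X_1 ^+ 2
      + psi 'X_2 ^+ 2 - psi 'X_0 * psi 'X_1 * psi 'X_2
      - psi b%:MP.
    by rewrite /markov; ring.
  by rewrite psi0 psi1 psi2 psiC -vE -uE; ring.
have -> : psi (2 * 'X_2 - 'X_0 * 'X_1)
    = 2 * psi 'X_2 - psi 'X_0 * psi 'X_1 by ring.
rewrite psi0 psi1 psi2 -vE -uE.
set M := 'X^2 + _; set q' := psi q => E.
have sr : (size ((- (u * v))%:P * 'X + (u ^+ 2 + v ^+ 2 - 2 - b%:P%:P)%:P : {poly T})%R < 3)%N.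
  by rewrite size_MXaddC; case: ifP => // _; rewrite ltnS (leq_ltn_trans (size_polyC_leq1 _)).
have Mmon : M \is monic by rewrite monicE lead_coefDl ?size_polyXn ?lead_coefXn //.
have sM : size M = 3.
  by rewrite size_polyDl size_polyXn.
have E2 : f%:P + g%:P * (2 * 'X - u%:P * v%:P) = (2 * g)%:P * 'X + (f - g * (u * v))%:P.
  by ring.
have q0 : q' = 0.
  apply: contraTeq isT => q'0.
  have : (size (q' * M)%R < 3)%N.
    rewrite -E E2 size_MXaddC; case: ifP => // _.
    by rewrite ltnS (leq_ltn_trans (size_polyC_leq1 _)).
  by rewrite size_Mmonic // sM addn3 /= !ltnS leqn0 size_poly_eq0 (negPf q'0).
move: E; rewrite E2 q0 mul0r => E.
have g0 : g = 0.
  have /eqP := congr1 (fun p : {poly T} => p`_1) E.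
  rewrite coefD coefMX !coefC /= addr0 mulf_eq0 => /orP[|/eqP//].
  by rewrite -!polyC_natr !polyC_eq0 pnatr_eq0.
split=> //; have := congr1 (fun p : {poly T} => p`_0) E.
by rewrite coefD coefMX !coefC /= add0r g0 mul0r subr0.
Qed.

Lemma markov_deRham_coh : b ^+ 2 - 4 != 0 ->
  has_dim (deRham_coh A 0) 1 /\ has_dim (deRham_coh A 1) 0.
Proof.
move=> b4; have bb : (b - 2) * (b + 2) != 0.
  by rewrite -subr_sqr -natrX.
have b2 : b - 2 != 0 by apply: contraNneq bb => ->; rewrite mul0r.
have b2' : b + 2 != 0 by apply: contraNneq bb => ->; rewrite mulr0.
have four : (4 : K) != 0 by rewrite pnatr_eq0.
have m0 : 8 - 4 * b != 0.
  rewrite (_ : _ - _ = - 4 * (b - 2)) ?mulf_neq0 ?oppr_eq0 //; ring.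
have m16 : 8 - 4 * b != 16.
  rewrite -subr_eq0 (_ : _ - _ = - 4 * (b + 2)) ?mulf_neq0 ?oppr_eq0 //; ring.
have [exact1 const] := closed_exact_double_plane (dX_disc _) (dY_disc _) (disc_neq0 _)
  (disc_smooth m0 m16) (@twisted_poincare K _) (@twistX_eq0 K _)
  coord_evC coord_w_sqr coord_gen coord_free.
split; last exact: deRham_coh1.
apply: deRham_coh0 => // c; rewrite -coord_evC => ev0.
have [|/eqP] := @coord_free c%:P%:P 0; first by rewrite rmorph0 mul0r addr0.
by rewrite !polyC_eq0 => /eqP.
Qed.

End MarkovCubic.

Theorem mainTheorem7 (R : realType) (b : R[i]) :
  b ^+ 2 - 4 != 0 ->
  has_dim (deRham_coh (coord_ring b) 0) 1 /\
  has_dim (deRham_coh (coord_ring b) 1) 0.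
Proof.
pose pi : {rmorphism {mpoly R[i][3]} -> coord_ring b} := @qalg_proj _ _ (boundary_ideal b).
apply: (@markov_deRham_coh _ b _ pi).
- by move=> c; rewrite -alg_mpolyC; apply/esym; exact: mulr1.
- by move=> a; exists (repr a); apply: reprK.
move=> p; rewrite -(rmorph0 pi).
have -> : (pi p = pi 0) <-> (p \in boundary_ideal b).
  rewrite -[p in X in _ <-> X]subr0 (@Quotient.idealrBE _ (boundary_ideal b)).
  by split=> /eqP.
by split=> [/asboolP|?]; last apply/asboolP.
Qed.
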